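(* Let $G_0$ be an infinite, connected, quasi-transitive, cubic graph, let $\phi$ be a local transformation and $G_1=\phi(G_0)$ (assumed connected). Let $W_0$ be a minimal fundamental domain of $G_0$ and $W_1$ the set of all vertices of the gadgets $\phi(v)$, $v\in W_0$ (a fundamental domain of $G_1$), with $X_k$ the set of edges of $G_k$ incident to vertices in $W_k$. Assume $|\gamma(G_0)|<\infty$. Then $\gamma(G_1)=\gamma(G_0)$. Moreover, if $\eta(G_1)$ exists, then $\eta(G_0)$ exists and $\eta(G_0)=\eta(G_1)$.
   Context: All graphs are simple (no loops, no multiple edges). A graph $G=(V,E)$ is quasi-transitive if there is a finite $W\subseteq V$ such that every vertex is mapped into $W$ by some automorphism of $G$ (such $W$ is a fundamental domain); it is cubic if every vertex has degree $3$. Local transformation: a local transformation $\phi$ acts at a degree-$3$ vertex $v$ of a simple graph by replacing $v$ with a finite connected graph (the gadget) $\phi(v)$ having three distinct distinguished outer vertices (ports) $w_1,w_2,w_3$, each port being attached to exactly one of the three edges formerly incident to $v$ (one port per edge). It is required that (i) all gadgets $\phi(v)$ are isomorphic via isomorphisms sending ports to ports, and (ii) some subgroup of the automorphism group of $\phi(v)$ preserves the set $\{w_1,w_2,w_3\}$ and acts transitively on it. $\phi(G)$ denotes the graph obtained by applying $\phi$ at every degree-$3$ vertex of $G$. Automorphisms of $G_0$ induce automorphisms of $G_1$. Mid-edge convention: each edge $e$ is identified with a point at its middle (also denoted $e$). Walks may start and end at mid-edges; such a walk is self-avoiding (a SAW) if it visits no vertex and no mid-edge more than once, and its length $|\pi|$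 is the number of vertices it visits. For quasi-transitive $G$, $\mu(G)$ denotes the connective constant $\lim_n \sigma_n(v)^{1/n}$ ($\sigma_n(v)$ the number of $n$-step SAWs from a vertex $v$). Exponents: for an infinite, connected, quasi-transitive graph $G$ with connective constant $\mu$, fundamental domain $W$, and $X$ the set of edges incident to vertices in $W$, let $\Sigma$ be the set of SAWs on $G$ starting at mid-edges in $X$. Set $Y(x,y)=\sum_{\pi\in\Sigma}x^{|\pi|}/|\pi|^{y}$ ($x>0$, $y\in\mathbb R$; denominator $1$ if $|\pi|=0$), and let $\gamma(G)\in[-\infty,\infty]$ be such that $Y(\mu^{-1},y)=\infty$ for $y<\gamma$ and $Y(\mu^{-1},y)<\infty$ for $y>\gamma$. For an automorphism $\alpha$ of $G$ let $Z_\alpha(x)=\sum_{\pi\in\Sigma(\alpha)}x^{|\pi|}$, where $\Sigma(\alpha)\subseteq\Sigma$ consists of SAWs ending at mid-edges in $\alpha X$. We say $\eta=\eta(G)\in[-\infty,\infty]$ exists if for every sequence of automorphisms $\alpha$ with $d_G(W,\alpha W)\to\infty$, $Z_\alpha(\mu^{-1})\,d_G(W,\alpha W)^{w}\to0$ for $w<\eta$ and $\to\infty$ for $w>\eta$. Here $d_G$ is graph distance. These exponents do not depend on the choice of $W$. *)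

(* Defs.v *)
From Stdlib Require List.
From HB Require Import structures.
From mathcomp Require Import all_boot all_order all_algebra fingroup perm.
From mathcomp Require Import all_classical all_reals all_analysis.
Set Implicit Arguments. Unset Strict Implicit. Unset Printing Implicit Defensive.
Import Order.TTheory GRing.Theory Num.Theory.
Local Open Scope classical_set_scope.
Local Open Scope ring_scope.

Section Graphs.
Variables (V : Type) (adj : V -> V -> Prop).

Definition simple_graph : Prop :=
  (forall u v, adj u v -> adj v u) /\ (forall v, ~ adj v v).

Fixpoint is_walk (s : list V) : Prop :=
  match s with
  | x :: ((y :: _) as t) => adj x y /\ is_walk t
  | _ => True
  end.

Definition walk_from_to (u v : V) (s : list V) : Prop :=
  is_walk (u :: s) /\ last u s = v.

Definition graph_connected : Prop := forall u v, exists s, walk_from_to u v s.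

Definition infinite_graph : Prop := ~ finite_set [set: V].

Definition degree3 (v : V) : Prop :=
  exists a b c, [/\ a <> b, a <> c, b <> c &
    forall w, adj v w <-> (w = a \/ w = b \/ w = c)].

Definition cubic : Prop := forall v, degree3 v.

Definition is_aut (f : V -> V) : Prop :=
  bijective f /\ forall u v, adj u v <-> adj (f u) (f v).

Definition fundamental_domain (W : set V) : Prop :=
  finite_set W /\ forall v, exists f, is_aut f /\ W (f v).

Definition quasi_transitive : Prop := exists W, fundamental_domain W.

Definition minimal_fundamental_domain (W : set V) : Prop :=
  fundamental_domain W /\
  forall W', W' `<=` W -> fundamental_domain W' -> W' = W.

(* an edge (identified with its mid-point) is the two-element set of its ends *)
Definition is_edge (e : set V) : Prop := exists a b, adj a b /\ e = [set a; b].

Definition incident_edges (W : set V) : set (set V) :=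
  [set e | is_edge e /\ exists w, W w /\ e w].

Fixpoint inner_edges (s : list V) : list (set V) :=
  match s with
  | x :: ((y :: _) as t) => [set x; y] :: inner_edges t
  | _ => nil
  end.

(* a SAW starting at mid-edge e0, visiting the vertices s (in order), and
   ending at mid-edge e1; it visits no vertex and no mid-edge twice *)
Definition saw_me (e0 : set V) (s : list V) (e1 : set V) : Prop :=
  is_edge e0 /\ is_edge e1 /\
  match s with
  | nil => e0 = e1
  | v :: _ => [/\ e0 v, e1 (last v s), is_walk s, List.NoDup s &
               List.NoDup (e0 :: inner_edges s ++ e1 :: nil)]
  end.

Definition Walk := {classic (set V * list V * set V)%type}.
Definition wstart (p : Walk) : set V := p.1.1.
Definition wverts (p : Walk) : list V := p.1.2.
Definition wend (p : Walk) : set V := p.2.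
Definition wlen (p : Walk) : nat := size (wverts p).

Definition Sigma (W : set V) : set Walk :=
  [set p | saw_me (wstart p) (wverts p) (wend p) /\
           incident_edges W (wstart p)].

Definition Sigma_aut (W : set V) (f : V -> V) : set Walk :=
  [set p | Sigma W p /\ exists e, incident_edges W e /\ wend p = f @` e].

Definition Vseq := {classic (list V)}.

Definition saw_count {R : realType} (n : nat) (v : V) : \bar R :=
  (\esum_(s in [set s : Vseq | is_walk (v :: s) /\ List.NoDup (v :: s)
                               /\ size s = n]) 1)%E.

Definition conn_const {R : realType} (v : V) : R :=
  limn (fun n : nat => (fine (@saw_count R n v)) `^ (n%:R^-1)).

Definition Yfun {R : realType} (W : set V) (x y : R) : \bar R :=
  (\esum_(p in Sigma W)
     ((x ^+ wlen p) / (if wlen p == 0%N then 1 else (wlen p)%:R `^ y))%:E)%E.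

Definition Zfun {R : realType} (W : set V) (f : V -> V) (x : R) : \bar R :=
  (\esum_(p in Sigma_aut W f) (x ^+ wlen p)%:E)%E.

Definition gamma_is {R : realType} (W : set V) (g : \bar R) : Prop :=
  forall v : V, forall y : R,
    ((y%:E < g)%E -> Yfun W (@conn_const R v)^-1 y = +oo%E) /\
    ((g < y%:E)%E -> (Yfun W (@conn_const R v)^-1 y < +oo)%E).

Definition set_dist {R : realType} (A B : set V) : R :=
  inf [set (n%:R : R) | n in
       [set n : nat | exists u u' s, [/\ A u, B u', walk_from_to u u' s &
                                         size s = n]]].

Definition eta_is {R : realType} (W : set V) (e : \bar R) : Prop :=
  forall (v : V) (alpha : nat -> V -> V),
    (forall k, is_aut (alpha k)) ->
    ((fun k => @set_dist R W (alpha k @` W)) @ \oo --> +oo) ->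
    forall w : R,
      ((w%:E < e)%E ->
        ((fun k => Zfun W (alpha k) (@conn_const R v)^-1 *
                   ((@set_dist R W (alpha k @` W)) `^ w)%:E)%E
           @ \oo --> 0%E)) /\
      ((e < w%:E)%E ->
        ((fun k => Zfun W (alpha k) (@conn_const R v)^-1 *
                   ((@set_dist R W (alpha k @` W)) `^ w)%:E)%E
           @ \oo --> +oo%E)).

End Graphs.

Section LocalTransformation.
Variables (V0 : Type) (adj0 : V0 -> V0 -> Prop).
Variables (U : finType) (eH : rel U) (P : {set U}).

Definition gadget_ok : Prop :=
  [/\ (forall x y, eH x y = eH y x), (forall x, ~~ eH x x),
      (forall x y, connect eH x y), #|P| = 3 &
      exists S : {group {perm U}},
        (forall s, s \in S ->
           (forall x y, eH (s x) (s y) = eH x y) /\ (s @: P)%g = P) /\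
        (forall i j, i \in P -> j \in P -> exists2 s, s \in S & s i = j)].

(* port v w = the port of the gadget phi(v) attached to the edge {v,w};
   at each vertex, the three edges correspond bijectively to the ports *)
Definition port_labelling (port : V0 -> V0 -> U) : Prop :=
  forall v,
    [/\ (forall w, adj0 v w -> port v w \in P),
        (forall w w', adj0 v w -> adj0 v w' -> port v w = port v w' -> w = w') &
        (forall x, x \in P -> exists w, adj0 v w /\ port v w = x)].

(* phi(G0): vertex set V0 * U (vertex (v,x) = vertex x of the gadget phi(v)) *)
Definition phi_adj (port : V0 -> V0 -> U) (a b : V0 * U) : Prop :=
  (a.1 = b.1 /\ eH a.2 b.2) \/
  (adj0 a.1 b.1 /\ a.2 = port a.1 b.1 /\ b.2 = port b.1 a.1).

Definition gadget_domain (W0 : set V0) : set (V0 * U) := [set a | W0 a.1].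

End LocalTransformation.

(* Main.v *)
(** Proof idea. In a cubic graph a walk between mid-edges that repeats no
    mid-edge repeats no vertex, since two visits to a vertex of degree 3 would use
    four edge-ends. Contracting the gadgets therefore maps the self-avoiding walks of
    G1 to self-avoiding walks of G0, up to a bounded initial and final piece inside
    one gadget; conversely a self-avoiding walk of G0 with n vertices lifts to those of
    G1 by choosing, in each visited gadget, a self-avoiding path between two ports.
    By the symmetry of the gadget the generating function h(x) of these paths does not
    depend on the two ports, so walk sums of G1 at x are comparable to walk sums of G0
    at h(x). Choosing x1 with h(x1) = 1/mu(G0), finiteness of gamma(G0) shows that x1
    is the radius of convergence for G1, and Hammersley's theorem gives
    x1 = 1/mu(G1). Both exponents then transfer, as distances in G0 and G1 are
    comparable. *)
From Stdlib Require List.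
Require Import Defs.
From HB Require Import structures.
From mathcomp Require Import all_boot all_order all_algebra fingroup perm.
From mathcomp Require Import all_classical all_reals all_analysis.
From mathcomp Require Import lra zify ring.
Import Order.TTheory GRing.Theory Num.Theory.
Local Open Scope classical_set_scope.
Local Open Scope ring_scope.
Set Implicit Arguments. Unset Strict Implicit. Unset Printing Implicit Defensive.

(** * Sums of nonnegative extended reals over sets *)

(** [conn_const] is a [limn] of roots, so nothing is known of it until the roots are shown to
    converge at each vertex. In a graph that is not transitive, submultiplicativity bounds walk
    counts only through their maximum over vertices; the lower bound at a given vertex comes from
    contagion. If a vertex has at most [(th / x1) ^+ n] walks of some large length [n], with
    [th < 1], then its neighbours are deficient at length [2 * n], and after [d] rounds all vertices
    are deficient at length [2 ^ d * n]. Walk sums at [x1] would then converge geometrically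
    whatever the polynomial weight. Finiteness of gamma excludes this: it gives divergence for one
    power weight and convergence for another, and exponential rates do not see the difference. Walks
    confined to one gadget have no contraction. For gamma there are finitely many of them near [W1];
    for eta there are none once the two domains are at positive distance. Sums are compared through
    trails, which also record the outer ends of the two extreme mid-edges and so allow induction on
    the list of vertices; a walk comes from at most two trails. *)

Section EsumTools.
Local Open Scope ereal_scope.
Context {R : realType}.

Lemma esum_subset (T : choiceType) (A B : set T) (a : T -> \bar R) :
  A `<=` B -> \esum_(i in A) a i <= \esum_(i in B) a i.
Proof.
move=> AB; apply: ge_ereal_sup => /= _ [X [finX XA]] <-.
by apply: ereal_sup_ubound; exists X => //; split=> // t /XA /AB.
Qed.

Lemma esum_inj_le (T T' : choiceType) (A : set T) (B : set T') (e : T -> T')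
    (a : T -> \bar R) (b : T' -> \bar R) :
  (forall x, A x -> B (e x)) ->
  (forall x y, A x -> A y -> e x = e y -> x = y) ->
  (forall x, A x -> a x <= b (e x)) ->
  \esum_(i in A) a i <= \esum_(i in B) b i.
Proof.
move=> AB inje ab.
apply: (@le_trans _ _ (\esum_(i in A) b (e i))); first exact: le_esum.
rewrite -esum_image; first by apply: esum_subset => _ [x Ax <-]; exact: AB.
by move=> x y; rewrite !inE => Ax Ay; exact: inje.
Qed.

(* The code of [x] is chosen classically; decodability makes the choice injective. *)
Lemma esum_code_le (T T' : choiceType) (A : set T) (B : set T') (d : T' -> T)
    (a : T -> \bar R) (b : T' -> \bar R) :
  (forall x, A x -> exists y, [/\ B y, d y = x & a x <= b y]) ->
  \esum_(i in A) a i <= \esum_(i in B) b i.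
Proof.
move=> H.
case: (pselect (exists x, A x)) => [[x0 Ax0]|nA]; last first.
  have -> : A = set0 by rewrite predeqE => x; split=> // Ax; apply: nA; exists x.
  rewrite esum_set0; apply: ereal_sup_ubound.
  by exists set0; [exact: fsets_set0|rewrite fsbig_set0].
have [y0 _] := H _ Ax0.
have : forall x, exists y, A x -> [/\ B y, d y = x & a x <= b y].
  move=> x; case: (pselect (A x)) => [/H[y Hy]|]; first by exists y.
  by exists y0.
move=> /choice[e He].
apply: (@esum_inj_le _ _ _ _ e) => [x /He[]//|x y Ax Ay exy|x /He[]//].
have [_ <- _] := He _ Ax; have [_ <- _] := He _ Ay.
by rewrite exy.
Qed.

Lemma esumZl (T : choiceType) (A : set T) (c : R) (a : T -> \bar R) :
  (0 <= c)%R -> (forall i, 0 <= a i) ->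
  \esum_(i in A) (c%:E * a i) = c%:E * \esum_(i in A) a i.
Proof.
have le (k : R) (b : T -> \bar R) : (0 <= k)%R -> (forall i, 0 <= b i) ->
    \esum_(i in A) (k%:E * b i) <= k%:E * \esum_(i in A) b i.
  move=> k0 b0; apply: ge_ereal_sup => /= _ [X [finX XA]] <-.
  rewrite -ge0_mule_fsumr //; apply: lee_pmul => //; rewrite ?lee_fin //.
    by apply: fsume_ge0.
  by apply: ereal_sup_ubound; exists X.
move=> c0 a0; apply/eqP; rewrite eq_le le //=.
have [<-|cn0] := eqVneq 0%R c.
  by rewrite mul0e; apply: esum_ge0 => i _; rewrite mul0e.
have {cn0} c_gt0 : (0 < c)%R by rewrite lt_neqAle cn0.
rewrite -lee_pdivlMl //.
(* The reverse inequality is the bound [le] for the factor [c^-1] and the family [c * a]. *)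
have -> : \esum_(i in A) a i = \esum_(i in A) (c^-1%:E * (c%:E * a i)).
  by apply: eq_esum => i _; rewrite muleA -EFinM mulVf ?gt_eqF // mul1e.
apply: le; first by rewrite invr_ge0 ltW.
by move=> i; rewrite mule_ge0 // lee_fin ltW.
Qed.

(** The first factor is real so that [esumZl] can take it out of the inner sum, which may be
    infinite. *)
Lemma esum_setX (T T' : choiceType) (A : set T) (B : set T')
    (f : T -> R) (g : T' -> \bar R) :
  (forall i, 0 <= f i)%R -> (forall j, 0 <= g j) ->
  \esum_(k in A `*` B) ((f k.1)%:E * g k.2) =
  \esum_(i in A) ((f i)%:E * \esum_(j in B) g j).
Proof.
move=> f0 g0.
have -> : A `*` B = A `*`` (fun=> B) by [].
rewrite -(@esum_esum _ _ _ A (fun=> B) (fun i j => (f i)%:E * g j)).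
  by apply: eq_esum => i _; rewrite esumZl.
by move=> i j _ _; rewrite mule_ge0 // lee_fin.
Qed.

Lemma esum_finite_lty (T : choiceType) (A : set T) (a : T -> \bar R) :
  finite_set A -> (forall i, 0 <= a i) -> (forall i, A i -> a i < +oo) ->
  \esum_(i in A) a i < +oo.
Proof.
move=> finA a0 aoo; rewrite esum_fset // fsbig_finite //= big_seq.
apply: lte_sum_pinfty => i; rewrite in_fset_set // inE; exact: aoo.
Qed.

(** [C] is chosen before the family [a]; later bounds thus become uniform in the vertex or in the
    automorphism. *)
Lemma esum_cst_le (T : choiceType) (A : set T) (c : R) :
  finite_set A -> (0 <= c)%R ->
  exists2 C : R, (0 <= C)%R & forall a : T -> \bar R,
    (forall i, A i -> a i <= c%:E) -> \esum_(i in A) a i <= C%:E.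
Proof.
move=> finA c0; have : \esum_(i in A) (c%:E) < +oo.
  by apply: esum_finite_lty => // i *; rewrite ?lee_fin ?ltry.
have : 0 <= \esum_(i in A) (c%:E) by apply: esum_ge0 => *; rewrite lee_fin.
case E : (\esum_(i in A) _) => [r||] // r0 _.
exists r; first by rewrite -lee_fin.
by move=> b bc; rewrite -E; apply: le_esum.
Qed.

End EsumTools.

(** * Walks between mid-edges *)

Section Walks.
Variables (V : Type) (adj : V -> V -> Prop).
Implicit Types (a b x y : V) (s l : list V).

Lemma set2_eq a b x y :
  [set a; b] = [set x; y] -> (a = x /\ b = y) \/ (a = y /\ b = x).
Proof.
move=> E; have [ax|ay] : [set x; y] a by rewrite -E; left.
  left; split=> //; have [ya|//] : [set a; b] y by rewrite E; right.
  have [bx|//] : [set x; y] b by rewrite -E; right.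
  by rewrite bx -ax ya.
right; split=> //; have [xa|//] : [set a; b] x by rewrite E; left.
have [//|by_] : [set x; y] b by rewrite -E; right.
by rewrite by_ -ay xa.
Qed.

Lemma set2_eql a b x : [set a; x] = [set b; x] -> a = b.
Proof. by move=> /set2_eq[[]|[-> ->]]. Qed.

Lemma is_walk_tail x l : is_walk adj (x :: l) -> is_walk adj l.
Proof. by case: l => [//|y l] []. Qed.

(** The cut vertex [x] belongs to both halves, so no step is lost; an equality of propositions can
    be used for rewriting. *)
Lemma is_walk_cat l x l' :
  is_walk adj (l ++ x :: l') = (is_walk adj (l ++ [:: x]) /\ is_walk adj (x :: l')).
Proof.
apply/propext; elim: l => [|y [|z l] IH] /=; first by split=> [|[]].
  by split=> [[]|[[]]].
by rewrite /= in IH; split=> [[? /IH[]]|[[? ?] ?]]; split=> //; apply/IH.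
Qed.

Lemma inner_edges_cat l x l' :
  inner_edges (l ++ x :: l') = inner_edges (l ++ [:: x]) ++ inner_edges (x :: l').
Proof.
elim: l => [//|y [|z l] IH] //.
by rewrite /= in IH *; rewrite IH.
Qed.

Lemma inner_edges_rcons x l y :
  inner_edges (x :: l ++ [:: y]) = inner_edges (x :: l) ++ [:: [set last x l; y]].
Proof.
elim/last_ind: l => [//|l z _].
rewrite -cats1 -catA -!cat_cons [in LHS](inner_edges_cat (x :: l) z) /=.
by rewrite last_cat.
Qed.

Lemma is_walk_rcons x l y :
  is_walk adj (x :: l ++ [:: y]) = (is_walk adj (x :: l) /\ adj (last x l) y).
Proof.
apply/propext; elim/last_ind: l => [/=|l z _]; first by split=> [[]|[]].
rewrite -cats1 -catA last_cat -[x :: (l ++ _)]/((x :: l) ++ [:: z; y]).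
have /= := is_walk_cat (x :: l) z [:: y].
by move=> ->; split=> [[? []]|[? ?]].
Qed.

Lemma in_inner_edges l (e : set V) x : List.In e (inner_edges l) -> e x -> List.In x l.
Proof.
elim: l => [//|y [//|z l] IH] /= [<- [->|->]|/IH H /H]; auto.
Qed.

Lemma NoDup_inner_edges l : List.NoDup l -> List.NoDup (inner_edges l).
Proof.
elim: l => [|y [|z l] IH] /=; do ?by move=> _; constructor.
move=> /List.NoDup_cons_iff [yl /IH H]; constructor=> //.
by move=> H'; apply: yl; apply: (@in_inner_edges (z :: l) _ y H'); left.
Qed.

Lemma is_walk_map (W : Type) (adj' : W -> W -> Prop) (f : V -> W) l :
  (forall x y, adj x y -> adj' (f x) (f y)) ->
  is_walk adj l -> is_walk adj' (map f l).
Proof.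
move=> H; elim: l => [//|x [//|y l] IH] [xy /IH Hl]; split=> //; exact: H.
Qed.

Lemma is_walk_rev l : (forall x y, adj x y -> adj y x) ->
  is_walk adj l -> is_walk adj (rev l).
Proof.
move=> sym; elim: l => [//|x [//|y l] IH] [xy /IH].
rewrite (rev_cons x) (rev_cons y) -!cats1 -catA => Hl /=.
by rewrite is_walk_cat; split=> //=; split=> //; exact: sym.
Qed.

(* [trail a s b] is a walk from the mid-edge {a, head s} to the mid-edge
   {last s, b} whose visited vertices are [s]. *)
Definition trail a s b : Prop :=
  [/\ is_walk adj (a :: s ++ [:: b]), List.NoDup s &
      List.NoDup (inner_edges (a :: s ++ [:: b]))].

(** The defaults of [head] and [last] make both extreme mid-edges equal to {a, b} when no vertex is
    visited. *)
Definition first_edge a s b : set V := [set a; head b s].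
Definition last_edge a s b : set V := [set last a s; b].

Definition Trail := {classic (V * list V * V)%type}.

Definition trails (E E' : set (set V)) : set Trail :=
  [set t | [/\ trail t.1.1 t.1.2 t.2, E (first_edge t.1.1 t.1.2 t.2) &
               E' (last_edge t.1.1 t.1.2 t.2)]].

Definition walk_of_trail (t : Trail) : Walk V :=
  (first_edge t.1.1 t.1.2 t.2, t.1.2, last_edge t.1.1 t.1.2 t.2).

Hypothesis adj_simple : simple_graph adj.

Let sym x y : adj x y -> adj y x. Proof. exact: (proj1 adj_simple). Qed.
Let irr x : ~ adj x x. Proof. exact: (proj2 adj_simple). Qed.

Lemma edge_other_end (e : set V) x : is_edge adj e -> e x ->
  exists2 y, adj x y & e = [set x; y].
Proof.
move=> [a [b [ab ->]]] [->|->]; first by exists b.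
by exists a; [exact: sym|rewrite setUC].
Qed.

Lemma saw_me_trail e s e' : saw_me adj e s e' ->
  exists a b, [/\ trail a s b, e = first_edge a s b & e' = last_edge a s b].
Proof.
case: s => [|v s] [edge [edge' H]].
  case: edge => a [b [ab ab_e]]; exists a, b.
  rewrite -H ab_e; split=> //; split=> //=; do ?constructor; auto.
case: H => /(edge_other_end edge)[a va ->] /(edge_other_end edge')[b vb ->].
rewrite (setUC [set v]) => walk nodup nodupe; exists a, b; split=> //.
split=> //; last by rewrite inner_edges_rcons.
by rewrite is_walk_rcons; split=> //; split=> //; exact: sym.
Qed.

Lemma trail_saw_me a s b : trail a s b -> saw_me adj (first_edge a s b) s (last_edge a s b).
Proof.
rewrite /trail inner_edges_rcons is_walk_rcons => -[[walk lb] nodup nodupe].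
have ah : adj a (head b s) by case: s walk lb {nodup nodupe} => [|? ?] //= [].
split; first by exists a, (head b s).
split; first by exists (last a s), b.
case: s walk lb nodup nodupe ah => [//|v s] [av walk] lb nodup nodupe ah.
by split=> //; [right|left].
Qed.

End Walks.

(** * Sums over walks against sums over trails *)

Section WalkSums.
Local Open Scope ereal_scope.
Context {R : realType} (V : Type) (adj : V -> V -> Prop).
Hypothesis adj_simple : simple_graph adj.

Definition midwalks (E E' : set (set V)) : set (Walk V) :=
  [set p | saw_me adj (wstart p) (wverts p) (wend p) /\ (E (wstart p) /\ E' (wend p))].

Lemma esum_midwalks_le (E E' : set (set V)) (F : nat -> R) :
  \esum_(p in midwalks E E') (F (wlen p))%:E <=
  \esum_(t in trails adj E E') (F (size t.1.2))%:E.
Proof.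
apply: (@esum_code_le _ _ _ _ _ (@walk_of_trail V)) => -[[e s] e'] [].
move=> /(saw_me_trail adj_simple)[a [b [T ee ee']]] [Ee Ee'].
rewrite /wstart /wend /wverts /wlen /= in T ee ee' Ee Ee' *.
exists (a, s, b); rewrite /trails /walk_of_trail /= -ee -ee'.
by split.
Qed.

(* The only trails not determined by their walk are the two orientations of an
   edge, when no vertex is visited. *)
Lemma esum_trails_le (E E' : set (set V)) (F : nat -> R) : (forall n, 0 <= F n)%R ->
  \esum_(t in trails adj E E') (F (size t.1.2))%:E <=
  (\esum_(p in midwalks E E') (F (wlen p))%:E) * (\esum_(b in [set: bool]) 1).
Proof.
move=> F0.
(* [r] marks one end of each edge. The boolean of the injection below tells whether the trail starts
   at the marked end, which separates the two orientations of an edge. *)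
have /choice[r Hr] (e : set V) :
    exists o : option V, if o is Some x then e x else forall x, ~ e x.
  case: (pselect (exists x, e x)) => [[x ex]|nx]; first by exists (Some x).
  by exists None => x ex; apply: nx; exists x.
have <- : \esum_(k in midwalks E E' `*` [set: bool]) ((F (wlen k.1))%:E * 1) =
    (\esum_(p in midwalks E E') (F (wlen p))%:E) * (\esum_(b in [set: bool]) 1).
  rewrite (@esum_setX _ _ _ _ _ (fun p => F (wlen p)) (fun=> 1)) //.
  rewrite muleC -[\esum_(b in _) 1]fineK.
    rewrite -esumZl //; first by apply: eq_esum => p _; rewrite muleC.
      by apply: fine_ge0; apply: esum_ge0.
    by move=> p; rewrite lee_fin.
  rewrite ge0_fin_numE; last exact: esum_ge0.
  by apply: esum_finite_lty => [|//|b _]; [exact: finite_finset|rewrite ltry].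
apply: (@esum_inj_le _ _ _ _ _
  (fun t : Trail V => (walk_of_trail t, `[< r (first_edge t.1.1 t.1.2 t.2) = Some t.1.1 >]))).
- move=> [[a s] b] [T Ea Eb]; split=> //; split=> //=; exact: trail_saw_me.
- move=> [[a s] b] [[c s'] d] [/= T Ea Eb] [/= T' Ec Ed] [E1 E2 E3 E4].
  move: E1 E3 E4; subst s' => {T' Ec Ed}.
  have irr x : ~ adj x x by apply: (proj2 adj_simple).
  case: s T Ea Eb => [|v s] T Ea Eb; last first.
    move=> E1 E3 _; rewrite (set2_eql E1).
    move: E3; rewrite /last_edge /= !(setUC [set last v s]) => E3.
    by rewrite (set2_eql E3).
  have {}Hr := Hr (first_edge a [::] b).
  move=> E1; rewrite -E1 => _ E4.
  have {E4} : r (first_edge a [::] b) = Some a <-> r (first_edge a [::] b) = Some c.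
    by split=> /asboolP H; apply/asboolP; [rewrite -E4|rewrite E4].
  move: Hr E1; rewrite /first_edge /= => Hr E1 H.
  have [[-> ->] //|[ad bc]] := set2_eq E1; subst d c.
  case: (r _) Hr H => [x [] -> H|/(_ a) H]; last by case: H; left.
    by case: (proj1 H erefl) => ->.
  by case: (proj2 H erefl) => ->.
- by move=> [[a s] b] _ /=; rewrite mule1.
Qed.

End WalkSums.

(** * Trails in cubic graphs *)

Section Cubic.
Variables (V : Type) (adj : V -> V -> Prop).
Hypotheses (adj_simple : simple_graph adj) (adj_cubic : cubic adj).

Lemma last_split (x : V) l : exists l', x :: l = l' ++ [:: last x l].
Proof. by case/lastP: l => [|l y]; [exists [::]|exists (x :: l); rewrite last_rcons cats1]. Qed.

(* Two visits to a vertex of degree 3 use four edge-ends, hence some edge twice. *)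
Lemma cubic_trail a s b :
  is_walk adj (a :: s ++ [:: b]) -> List.NoDup (inner_edges (a :: s ++ [:: b])) ->
  List.NoDup s.
Proof.
have [sym irr] := adj_simple.
elim: s a => [|v s IH] a; first by move=> *; constructor.
move=> walk nodup; constructor; last first.
  by apply: (IH v); [exact: is_walk_tail walk|case/List.NoDup_cons_iff: nodup].
move=> /(@List.in_split _ v s)[l1 [l2 E]].
move: walk nodup {IH}; rewrite {}E.
case: l1 => [|n l1] walk nodup; first by case: walk => _ [/irr].
have [l' E'] := last_split n l1; set p := last n l1 in E'.
have [m [l3 E3]] : exists m l3, l2 ++ [:: b] = m :: l3.
  by case: l2 {walk nodup} => [|m l2] /=; [exists b, [::]|exists m, (l2 ++ [:: b])].
(* The neighbours of [v] along the walk are [a] and [n] at the first visit, [p] and [m] at the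
   second. If [l1] is empty then [p] is [n], and the edge between [v] and [n] is used twice. *)
have E4 : a :: (v :: (n :: l1) ++ v :: l2) ++ [:: b] =
    [:: a, v & l'] ++ p :: [:: v, m & l3].
  by rewrite -[(_ :: _ ++ _) ++ _]/(v :: (((n :: l1) ++ v :: l2) ++ [:: b])) E' -!catA /= E3.
have [c [d [e [cd ce de Hv]]]] := adj_cubic v.
have va : adj v a by apply: sym; case: walk.
have vn : adj v n by case: walk => _ [].
have vp : adj v p.
  move: walk; rewrite E4 is_walk_cat => -[_ []] /sym //.
have vm : adj v m by move: walk; rewrite E4 is_walk_cat => -[_ [_ []]].
have nd2 : List.NoDup (inner_edges ([:: a, v & l'] ++ [:: p]) ++
     [:: [set p; v], [set v; m] & inner_edges (m :: l3)]).
  by move: nodup; rewrite E4 inner_edges_cat.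
have E5 : [:: a, v & l'] ++ [:: p] = [:: a, v, n & l1] by rewrite /= -E'.
rewrite {}E5 /= in nd2.
case/List.NoDup_cons_iff: nd2 => n1 /List.NoDup_cons_iff[n2 nd3].
have [n3 _] := proj1 (List.NoDup_cons_iff _ _) (List.NoDup_app_remove_l _ _ nd3).
have an : a <> n by move=> an; apply: n1; left; rewrite an setUC.
have pm : p <> m by move=> pm; apply: n3; left; rewrite pm setUC.
have in_p x : x = p -> List.In [set v; x] (inner_edges (n :: l1) ++
    [:: [set p; v], [set v; m] & inner_edges (m :: l3)]).
  by move=> ->; apply/List.in_or_app; right; left; rewrite setUC.
have in_m x : x = m -> List.In [set v; x] (inner_edges (n :: l1) ++
    [:: [set p; v], [set v; m] & inner_edges (m :: l3)]).
  by move=> ->; apply/List.in_or_app; right; right; left.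
have ap : a <> p by move=> /in_p ?; apply: n1; right; rewrite setUC.
have am : a <> m by move=> /in_m ?; apply: n1; right; rewrite setUC.
have np : n <> p by move=> /in_p.
have nm : n <> m by move=> /in_m.
move: va vn vp vm => /Hv + /Hv + /Hv + /Hv; clear -an ap am np nm pm.
by intuition congruence.
Qed.
End Cubic.

(** * Connective constants: Hammersley's theorem *)

Section RealTools.
Context {R : realType}.

Lemma poly_geometric_bounded (k : nat) (r : R) : 0 <= r < 1 ->
  exists2 C : R, 0 < C & forall n, n.+1%:R ^+ k * r ^+ n <= C.
Proof.
elim: k r => [|k IH] r /andP[r0 r1].
  exists 1 => // n; rewrite expr0 mul1r; apply: exprn_ile1 => //; exact: ltW.
(* Since [r <= s * s], one factor [s ^+ n] can absorb one factor [n.+1], and the other is left to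
   the induction hypothesis. *)
pose s := (1 + r) / 2.
have s0 : 0 <= s by rewrite /s; lra.
have s1 : s < 1 by rewrite /s; lra.
have rss : r <= s * s by rewrite /s; nra.
have [C C0 HC] := IH s (introT andP (conj s0 s1)).
(* Each of the [n.+1] terms of the geometric sum up to [s ^+ n] is at least [s ^+ n]. *)
have lin n : n.+1%:R * (1 - s) * s ^+ n <= 1.
  suff : n.+1%:R * s ^+ n * (1 - s) <= 1 - s ^+ n.+1.
    have := exprn_ge0 n.+1 s0; lra.
  elim: n => [|n IHn]; first by rewrite expr0 expr1; lra.
  have sn0 := exprn_ge0 n s0; have sn1 := exprn_ge0 n.+1 s0.
  have n1 : (0 : R) <= n.+1%:R by [].
  move: IHn; rewrite !exprS -[n.+2]addn1 natrD => IHn.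
  have : (n.+1%:R * s ^+ n * (1 - s)) * s <= (1 - s * s ^+ n) * s.
    by apply: ler_wpM2r.
  have : 0 <= (1 - s) * (1 - s * s ^+ n).
    by rewrite mulr_ge0 ?subr_ge0 -?exprS ?exprn_ile1 // ltW.
  lra.
exists (C / (1 - s)); first by rewrite divr_gt0 // ?subr_gt0.
move=> n; rewrite ler_pdivlMr ?subr_gt0 //.
have rn : r ^+ n <= s ^+ n * s ^+ n.
  by rewrite -exprMn lerXn2r // nnegrE // mulr_ge0.
apply: (@le_trans _ _ (n.+1%:R ^+ k.+1 * (s ^+ n * s ^+ n) * (1 - s))).
  apply: ler_wpM2r; first by rewrite subr_ge0 ltW.
  by apply: ler_wpM2l => //; rewrite exprn_ge0.
have -> : n.+1%:R ^+ k.+1 * (s ^+ n * s ^+ n) * (1 - s) =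
  (n.+1%:R ^+ k * s ^+ n) * (n.+1%:R * (1 - s) * s ^+ n) by rewrite exprS; ring.
rewrite -[leRHS]mulr1; apply: ler_pM => //.
  by rewrite mulr_ge0 ?exprn_ge0.
by rewrite !mulr_ge0 ?exprn_ge0 //; lra.
Qed.

Lemma poly_geometric_small (r C : R) : 0 <= r < 1 ->
  exists N, forall n, (N <= n)%N -> C * n.+1%:R * r ^+ n <= 1.
Proof.
(* The exponent 2 leaves a spare factor [n.+1], which eventually beats the constant. *)
move=> r01; have [B B0 HB] := poly_geometric_bounded 2 r01.
pose A := `|C| * B; exists (Num.truncn A) => n Nn.
have An : A <= n.+1%:R.
  by apply: ltW; apply: (lt_le_trans (truncnS_gt _)); rewrite ler_nat.
have n0 : (0 : R) < n.+1%:R by [].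
apply: (@le_trans _ _ (`|C| * n.+1%:R * r ^+ n)).
  apply: ler_wpM2r; first by rewrite exprn_ge0 //; case/andP: r01.
  by apply: ler_wpM2r => //; exact: ler_norm.
rewrite -(ler_pM2r n0) mul1r; apply: le_trans An.
have -> : `|C| * n.+1%:R * r ^+ n * n.+1%:R = `|C| * (n.+1%:R ^+ 2 * r ^+ n) by ring.
by apply: ler_wpM2l.
Qed.

Lemma esum_geometric_lty (C r : R) : 0 <= C -> 0 <= r < 1 ->
  (\esum_(n in [set: nat]) (C * r ^+ n)%:E < +oo)%E.
Proof.
move=> C0 /andP[r0 r1].
have pos n : (0 <= (C * r ^+ n)%:E)%E by rewrite lee_fin mulr_ge0 ?exprn_ge0.
rewrite -nneseries_esumT //.
apply: (@le_lt_trans _ _ (C / (1 - r))%:E); last by rewrite ltry.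
apply: lime_le; first by apply: is_cvg_nneseries => n _ _.
apply: nearW => n; rewrite sumEFin lee_fin -mulr_sumr.
apply: ler_wpM2l => //; rewrite -[leRHS]mul1r ler_pdivlMr ?subr_gt0 // big_mkord.
have := @subrXX R 1 r n; rewrite expr1n => geo.
have <- : \sum_(i < n) 1 ^+ (n.-1 - i) * r ^+ i = \sum_(i < n) r ^+ i.
  by apply: eq_bigr => i _; rewrite expr1n mul1r.
by rewrite mulrC -geo gerBl exprn_ge0.
Qed.

End RealTools.

(** * Counting self-avoiding walks from a vertex *)

Section SawCounts.
Local Open Scope ereal_scope.
Context {R : realType} (V : Type) (adj : V -> V -> Prop) (D : R).
Hypothesis adj_simple : simple_graph adj.
Hypothesis degree_le :
  forall v, \esum_(u in [set u : {classic V} | adj v u]) 1 <= D%:E.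

Definition saws (n : nat) (v : V) : set (Vseq V) :=
  [set s | is_walk adj (v :: s) /\ List.NoDup (v :: s) /\ size s = n].

Definition saw_nb (n : nat) (v : V) : R := fine (@saw_count V adj R n v).

Lemma esum_ord (n : nat) (a : 'I_n -> \bar R) : (forall i, 0 <= a i) ->
  \esum_(i in [set: 'I_n]) a i = \sum_(i < n) a i.
Proof.
move=> a0; rewrite esum_fset; [|exact: finite_finset|by []].
have -> : [set: 'I_n] = [set` enum 'I_n].
  by rewrite predeqE => i; split=> // _; rewrite /= mem_enum.
by rewrite -fsbig_seq ?enum_uniq // big_enum.
Qed.

Lemma list_rev (T : Type) (l : list T) : List.rev l = rev l.
Proof. by elim: l => //= x l ->; rewrite rev_cons -cats1. Qed.

Lemma saws_split m n v s : saws (m + n) v s ->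
  exists s1 s2, [/\ s = s1 ++ s2, saws m v s1 & saws n (last v s1) s2].
Proof.
move=> [walk [nodup sz]]; exists (take m s), (drop m s); rewrite cat_take_drop.
move: walk nodup; rewrite -{1 2}(cat_take_drop m s) -cat_cons.
have [l E] := last_split v (take m s); rewrite E.
rewrite -catA cat1s is_walk_cat => -[walk1 walk2] nodup.
have nodup1 : List.NoDup (l ++ [:: last v (take m s)]).
  by move: nodup; rewrite -cat1s catA => /List.NoDup_app_remove_r.
have nodup2 := List.NoDup_app_remove_l _ _ nodup.
split=> //; split; rewrite ?E //; split=> //; last by rewrite size_drop sz addKn.
by rewrite size_takel // sz leq_addr.
Qed.

(** Cutting after [m] steps leaves a walk from an unknown vertex, hence a bound [B] valid at all
    vertices. *)
Lemma saw_count_add m n v (B : R) :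
  (0 <= B)%R -> (forall u, @saw_count V adj R n u <= B%:E) ->
  @saw_count V adj R (m + n) v <= B%:E * @saw_count V adj R m v.
Proof.
move=> B0 HB; apply: (@le_trans _ _
   (\esum_(s in saws m v) \esum_(s' in saws n (last v s)) 1)).
  rewrite esum_esum //; apply: (@esum_code_le _ _ _ _ _ (fun p : Vseq V * Vseq V => p.1 ++ p.2 : Vseq V)).
  by move=> s /saws_split[s1 [s2 [-> H1 H2]]]; exists (s1, s2).
rewrite -esumZl //; apply: le_esum => s _; rewrite mule1; exact: HB.
Qed.

Lemma degree_ge0 (v : V) : (0 <= D)%R.
Proof. by rewrite -lee_fin (le_trans _ (degree_le v)) // esum_ge0. Qed.

Lemma saw_count_le n v : @saw_count V adj R n v <= (D ^+ n)%:E.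
Proof.
have D0 := degree_ge0 v.
elim: n v => [|n IH] v.
  apply: (@le_trans _ _ (\esum_(s in [set [::] : Vseq V]) 1)).
    by apply: esum_subset => s [_ [_ /size0nil]].
  by rewrite esum_set1.
rewrite -[n.+1]addn1 addnC exprD expr1 mulrC.
apply: (le_trans (saw_count_add 1 v _ IH)); first exact: exprn_ge0.
rewrite EFinM; apply: lee_pmul; rewrite ?lee_fin ?exprn_ge0 ?esum_ge0 //.
apply: le_trans (degree_le v).
apply: (@esum_code_le _ _ _ _ _ (fun u : {classic V} => [:: (u : V)] : Vseq V)).
move=> [|u [|w t]] [walk [_ sz]] //.
by exists u; split=> //; case: walk.
Qed.

Lemma saw_countE n v : @saw_count V adj R n v = (saw_nb n v)%:E.
Proof.
rewrite fineK // ge0_fin_numE ?esum_ge0 //.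
by rewrite (le_lt_trans (saw_count_le n v)) // ltry.
Qed.

Lemma saw_nb_ge0 n v : (0 <= saw_nb n v)%R.
Proof. by rewrite fine_ge0 // esum_ge0. Qed.

Lemma saw_nb_le n v : (saw_nb n v <= D ^+ n)%R.
Proof. by rewrite -lee_fin -saw_countE saw_count_le. Qed.

Lemma saw_nb_add m n v (B : R) : (forall u, (saw_nb n u <= B)%R) ->
  (saw_nb (m + n) v <= saw_nb m v * B)%R.
Proof.
move=> HB; have B0 := le_trans (saw_nb_ge0 n v) (HB v).
rewrite -lee_fin mulrC EFinM -!saw_countE; apply: saw_count_add => // u.
by rewrite saw_countE lee_fin.
Qed.

Lemma saw_nb_aut f n v : is_aut adj f -> (saw_nb n v <= saw_nb n (f v))%R.
Proof.
move=> [fbij fadj]; have finj := bij_inj fbij.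
rewrite -lee_fin -!saw_countE; apply: (@esum_inj_le _ _ _ _ _ (map f : Vseq V -> Vseq V)) => //.
- move=> s [walk [nodup sz]].
  have walk' : is_walk adj (map f (v :: s)) by apply: is_walk_map walk => x y /fadj.
  have nodup' : List.NoDup (map f (v :: s)).
    by apply: List.NoDup_map_NoDup_ForallPairs nodup => x y _ _ /finj.
  by split=> //; split=> //; rewrite size_map.
- by move=> s t _ _; apply: inj_map.
Qed.

(* A self-avoiding walk from [u] either avoids [v], and can be prolonged to
   start at [v], or splits at [v] into two self-avoiding walks from [v]. *)
Lemma saw_nb_adj u v n : adj u v ->
  (saw_nb n u <= saw_nb n.+1 v + \sum_(k < n.+1) saw_nb k v * saw_nb (n - k) v)%R.
Proof.
move=> uv; have [sym irr] := adj_simple.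
have vu := sym _ _ uv; have Duv : u <> v by move=> E; apply: (irr v); rewrite -{1}E.
rewrite -lee_fin EFinD -!saw_countE.
rewrite /saw_count (esumID [set s : Vseq V | List.In v s]) // addeC.
apply: leeD.
  apply: (@esum_inj_le _ _ _ _ _ (cons u : Vseq V -> Vseq V)) => //; last by move=> s t _ _ [].
  move=> s [[walk [nodup sz]] vs]; split; first by [].
  split; last by rewrite /= sz.
  by constructor=> // -[].
rewrite -sumEFin.
under eq_bigr => k _ do rewrite EFinM -!saw_countE.
have -> : \sum_(k < n.+1) (@saw_count V adj R k v * @saw_count V adj R (n - k) v) =
    \esum_(k in [set: 'I_n.+1] `*`` (fun k => saws k v `*` saws (n - k) v)) 1.
  rewrite -(@esum_esum _ _ _ _ _ (fun _ _ => 1)) // esum_ord; last first.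
    by move=> i; exact: esum_ge0.
  apply: eq_bigr => k _; rewrite (saw_countE (n - k)) muleC -esumZl ?saw_nb_ge0 //.
  transitivity (\esum_(p in saws k v `*` saws (n - k) v) (1%:E * 1)%E : \bar R).
    rewrite (@esum_setX _ _ _ _ _ (fun=> 1%R) (fun=> 1)) //.
    by apply: eq_esum => s _; rewrite mul1e mule1 -saw_countE.
  by apply: eq_esum => p _; rewrite mul1e.
(* The first component is the initial piece reversed, a walk from [v] back to [u]; decoding reverses
   it again, drops [u], and reinserts [v]. *)
apply: (@esum_code_le _ _ _ _ _ (fun p : 'I_n.+1 * (Vseq V * Vseq V) =>
   behead (rev p.2.1) ++ v :: p.2.2 : Vseq V)).
move=> s [[walk [nodup sz]] /(@List.in_split _ v)[s1 [s2 E]]].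
rewrite {}E in walk nodup sz *.
have k_lt : ((size s1).+1 < n.+1)%N by rewrite ltnS -sz size_cat /=; lia.
exists (Ordinal k_lt, (rev (u :: s1), s2)); split=> //; last first.
  by rewrite /= revK.
move: walk; rewrite -cat_cons is_walk_cat => -[walk1 walk2].
have {}nodup : List.NoDup (((u :: s1) ++ [:: v]) ++ s2) by rewrite -catA.
split=> //; split; last first.
  split=> //; split; last by rewrite /=; move: sz; rewrite size_cat /=; lia.
  by apply: (List.NoDup_app_remove_l (u :: s1)); rewrite -catA in nodup.
split; first by have := is_walk_rev sym walk1; rewrite cats1 rev_rcons.
split; last by rewrite size_rev.
have -> : v :: rev (u :: s1) = List.rev ((u :: s1) ++ [:: v]).
  by rewrite list_rev rev_cat.
by apply: List.NoDup_rev; exact: (List.NoDup_app_remove_r ((u :: s1) ++ [:: v]) s2).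
Qed.

End SawCounts.

Section EsumDep.
Local Open Scope ereal_scope.
Context {R : realType}.

Lemma esum_dep_le (T T' : choiceType) (I : set T) (J : T -> set T')
    (a : T * T' -> \bar R) (b : T -> \bar R) :
  (forall k, 0 <= a k) -> (forall i, I i -> \esum_(j in J i) a (i, j) <= b i) ->
  \esum_(k in I `*`` J) a k <= \esum_(i in I) b i.
Proof.
move=> a0 ab; have -> : \esum_(k in I `*`` J) a k =
    \esum_(k in I `*`` J) a (k.1, k.2).
  by apply: eq_esum => -[].
by rewrite -(@esum_esum _ _ _ I J (fun i j => a (i, j))) //; exact: le_esum.
Qed.

Lemma esum_le_cst (T : choiceType) (A : set T) (a : T -> \bar R) (c B : R) :
  (0 <= c)%R -> (forall i, A i -> a i <= c%:E) -> \esum_(i in A) 1 <= B%:E ->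
  \esum_(i in A) a i <= (c * B)%:E.
Proof.
move=> c0 ac HB; apply: (@le_trans _ _ (\esum_(i in A) (c%:E * 1))).
  by apply: le_esum => i Ai; rewrite mule1 ac.
by rewrite esumZl // EFinM; apply: lee_pmul; rewrite ?lee_fin ?esum_ge0.
Qed.

End EsumDep.

(** * Growth bounds from convergence and divergence at [x] *)

Section Hammersley.
Context {R : realType} (V : Type) (adj : V -> V -> Prop) (D : R).
Hypothesis adj_simple : simple_graph adj.
Hypothesis degree_le :
  forall v, (\esum_(u in [set u : {classic V} | adj v u]) 1 <= D%:E)%E.
Hypothesis adj_connected : graph_connected adj.
Variables (W : set V) (x : R) (k : nat).
Hypothesis W_dom : fundamental_domain adj W.
Hypothesis x_gt0 : 0 < x.

Let E := incident_edges adj W.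
Let mu := x^-1.
Let sg n v : R := saw_nb adj n v.
Let sg_ge0 n v : 0 <= sg n v. Proof. exact: saw_nb_ge0. Qed.

Let mu_gt0 : 0 < mu. Proof. by rewrite invr_gt0. Qed.

Lemma incident_edges_pair a v :
  E [set a; v] -> adj a v /\ (W a \/ W v).
Proof.
have [sym _] := adj_simple.
move=> [[c [d [cd cdE']]] [w [Ww [wa|wv]]]]; have cdE := set2_eq cdE'.
  by split; [case: cdE => -[-> ->] //; exact: sym|left; rewrite -wa].
by split; [case: cdE => -[-> ->] //; exact: sym|right; rewrite -wv].
Qed.

(** A term of a convergent nonnegative sum is at most the sum. After an automorphism has moved the
    start into [W], a walk of [n.+1] steps stripped of its two ends is a trail with [n] vertices. *)
Lemma saw_nb_poly_le :
  (\esum_(t in trails adj E setT) (x ^+ size t.1.2 / (size t.1.2).+1%:R ^+ k)%:E < +oo)%E ->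
  exists2 C : R, 0 < C & forall n u, sg n u <= C * n.+1%:R ^+ k * mu ^+ n.
Proof.
set S := (\esum_(t in _) _)%E => S_lty.
have S_ge0 : (0 <= S)%E.
  by apply: esum_ge0 => t _; rewrite lee_fin divr_ge0 ?exprn_ge0 // ltW.
have SE : S = (fine S)%:E by rewrite fineK // ge0_fin_numE.
have fS0 : 0 <= fine S by rewrite fine_ge0.
(* The 1 covers [n = 0]; the factor [x] pays for the shift between [n.+1] steps and [n] vertices. *)
exists (1 + fine S * x); first by rewrite ltr_pwDl // mulr_ge0 // ltW.
move=> n u; have [finW /(_ u)[f [f_aut Wfu]]] := W_dom.
apply: (le_trans (saw_nb_aut degree_le n u f_aut)); move: (f u) Wfu => w Ww {f_aut u f finW}.
case: n => [|n].
  rewrite expr0 mulr1 expr1n mulr1.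
  apply: (le_trans (saw_nb_le degree_le 0 w)).
  by rewrite expr0 lerDl mulr_ge0 // ltW.
have xn0 : 0 < x ^+ n by rewrite exprn_gt0.
have pn0 : (0 : R) < n.+1%:R ^+ k by rewrite exprn_gt0.
have : sg n.+1 w * (x ^+ n / n.+1%:R ^+ k) <= fine S.
  rewrite -lee_fin -SE mulrC EFinM /sg -(saw_countE degree_le) -esumZl //; last first.
    by rewrite divr_ge0 ?ltW.
  apply: (@esum_code_le _ _ _ _ _ (fun t : Trail V => t.1.2 ++ [:: t.2] : Vseq V)).
  move=> s; case/lastP: s => [|s b] [walk [nodup sz]] //.
  rewrite -cats1 in walk nodup sz *.
  exists (w, s, b); split=> //=; last first.
    by move: sz; rewrite size_cat /= addn1 => -[->]; rewrite mule1.
  split=> //=.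
    split=> //; last exact: NoDup_inner_edges.
    by move/List.NoDup_cons_iff: nodup => [_ /List.NoDup_app_remove_r].
  split; last by exists w; split=> //; left.
  exists w, (head b s); split=> //.
  by case: s walk {nodup sz} => [|v s] [].
rewrite mulrA ler_pdivrMr // -ler_pdivlMr // => /le_trans; apply.
rewrite /mu exprS exprVn.
have -> : (1 + fine S * x) * n.+2%:R ^+ k * (x^-1 / x ^+ n) =
   n.+2%:R ^+ k * (x^-1 + fine S) / x ^+ n by field; rewrite !gt_eqF.
rewrite ler_pM2r ?invr_gt0 // [leLHS]mulrC.
have pq : n.+1%:R ^+ k <= n.+2%:R ^+ k :> R by apply: lerXn2r; rewrite ?nnegrE // ler_nat.
have Sx : fine S <= x^-1 + fine S by rewrite lerDr ltW.
by apply: ler_pM => //; exact: ltW.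
Qed.

Lemma esum_edges_lty :
  (\esum_(p in [set p : {classic V} * {classic V} | adj p.1 p.2 /\ (W p.1 \/ W p.2)]) 1
     < +oo :> \bar R)%E.
Proof.
have [finW _] := W_dom; have [sym _] := adj_simple.
have K : (\esum_(k in (W : set {classic V}) `*`` (fun w => [set u : {classic V} | adj w u])) 1
     < +oo :> \bar R)%E.
  apply: (@le_lt_trans _ _ (\esum_(w in (W : set {classic V})) D%:E)).
    by apply: esum_dep_le => // w _; exact: degree_le.
  apply: esum_finite_lty => // w; last by rewrite ltry.
  by rewrite lee_fin (degree_ge0 degree_le w).
rewrite (esumID [set p : {classic V} * {classic V} | W p.1]) //; apply: lte_add_pinfty.
  apply: le_lt_trans K; apply: esum_subset => -[a b] [[/= ab _] Wa]; by split.
apply: le_lt_trans K.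
apply: (@esum_code_le _ _ _ _ _ (fun p : {classic V} * {classic V} => (p.2, p.1))) => -[a b] [[/= ab WW] nWa].
by exists (b, a); split=> //; split=> /=; [case: WW|exact: sym].
Qed.

(* Otherwise submultiplicativity would make the sum over trails converge geometrically. *)
Lemma saw_nb_not_deficient (th : R) (m : nat) :
  (\esum_(t in trails adj E setT) (x ^+ size t.1.2 * (size t.1.2).+1%:R ^+ k)%:E = +oo)%E ->
  0 < th < 1 -> (0 < m)%N -> ~ (forall u, sg m u <= (th * mu) ^+ m).
Proof.
move=> Hoo /andP[th0 th1] m0 Hm.
have [finW _] := W_dom.
have [v0 _] : exists v0 : V, True.
  case: (pselect (exists v0 : V, True)) => // nV; move: Hoo.
  rewrite (_ : trails adj E setT = set0) ?esum_set0 //.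
  by rewrite predeqE => -[[a s] b]; split=> // _; apply: nV; exists a.
have D0 := degree_ge0 degree_le v0.
have tm0 : 0 < th * mu by rewrite mulr_gt0.
(* Blocks of length [m] each bring a factor [(th * mu) ^+ m]; the fewer than [m] remaining steps are
   bounded by powers of the degree [D]. *)
pose C := 1 + \sum_(r < m) D ^+ r / (th * mu) ^+ r.
have sum_ge0 (P : pred 'I_m) : 0 <= \sum_(r < m | P r) D ^+ r / (th * mu) ^+ r.
  by apply: sumr_ge0 => r _; rewrite divr_ge0 // exprn_ge0 // ltW.
have C0 : 0 < C by rewrite ltr_pwDl.
have HC n u : sg n u <= C * (th * mu) ^+ n.
  elim/ltn_ind: n u => n IH u; have [nm|mn] := ltnP n m.
    apply: (le_trans (saw_nb_le degree_le n u)).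
    rewrite -ler_pdivrMr ?exprn_gt0 // /C (bigD1 (Ordinal nm)) //= addrCA lerDl.
    by rewrite addr_ge0.
  rewrite -(subnKC mn) exprD mulrCA.
  apply: (@le_trans _ _ (sg m u * (C * (th * mu) ^+ (n - m)))).
    apply: (saw_nb_add degree_le) => v; apply: IH; clear -mn m0; lia.
  by apply: ler_wpM2r; rewrite ?Hm // mulr_ge0 ?exprn_ge0 ?ltW //.
(* As [th <= tau * tau], one factor [tau ^+ n] absorbs the polynomial weight and the other makes the
   sum over [n] converge. *)
pose tau := (1 + th) / 2.
have tau01 : 0 <= tau < 1 by rewrite /tau; apply/andP; split; lra.
have th_tau : th <= tau * tau by rewrite /tau; nra.
have [B B0 HB] := poly_geometric_bounded k tau01.
pose F n : R := x ^+ n * n.+1%:R ^+ k.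
have F0 n : 0 <= F n by rewrite mulr_ge0 // exprn_ge0 // ltW.
have edges_lty := esum_edges_lty.
pose K := D * C * x * 2 ^+ k * B.
have K0 : 0 <= K by rewrite !mulr_ge0 // ?exprn_ge0 // ltW.
have Fbound n u : F n.+1 * D * sg n u <= K * tau ^+ n.
  apply: (@le_trans _ _ (F n.+1 * D * (C * (th * mu) ^+ n))).
    by apply: ler_wpM2l => //; rewrite mulr_ge0.
  have -> : F n.+1 * D * (C * (th * mu) ^+ n) = D * C * x * (n.+2%:R ^+ k * th ^+ n).
    rewrite /F /mu exprMn exprVn exprS; field; rewrite gt_eqF // exprn_gt0 //.
  have -> : K * tau ^+ n = D * C * x * (2 ^+ k * B * tau ^+ n) by rewrite /K; ring.
  apply: ler_wpM2l; first by rewrite !mulr_ge0 // ltW.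
  have /andP[tau0 _] := tau01.
  apply: (@le_trans _ _ (2 ^+ k * n.+1%:R ^+ k * (tau ^+ n * tau ^+ n))).
    apply: ler_pM; rewrite ?exprn_ge0 // ?(ltW th0) //.
      rewrite -exprMn; apply: lerXn2r; rewrite ?nnegrE ?mulr_ge0 //.
      by have n0 : (0 : R) <= n%:R by []; rewrite -(natr1 n.+1) -(natr1 n); lra.
    by rewrite -exprMn; apply: lerXn2r => //; rewrite nnegrE; [exact: ltW|exact: mulr_ge0].
  have -> : 2 ^+ k * n.+1%:R ^+ k * (tau ^+ n * tau ^+ n) =
    2 ^+ k * tau ^+ n * (n.+1%:R ^+ k * tau ^+ n) by ring.
  have -> : 2 ^+ k * B * tau ^+ n = 2 ^+ k * tau ^+ n * B by ring.
  by apply: ler_wpM2l => //; rewrite mulr_ge0 ?exprn_ge0.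
have [G G0 HG] : exists2 G : R, 0 <= G &
    (\esum_(n in [set: nat]) (K * tau ^+ n)%:E <= G%:E)%E.
  have geo := esum_geometric_lty K0 tau01.
  have geo0 : (0 <= \esum_(n in [set: nat]) (K * tau ^+ n)%:E)%E.
    by apply: esum_ge0 => n _; rewrite lee_fin mulr_ge0 ?exprn_ge0 //; case/andP: tau01.
  exists (fine (\esum_(n in [set: nat]) (K * tau ^+ n)%:E)); first exact: fine_ge0.
  by rewrite fineK // ge0_fin_numE.
pose EP : set ({classic V} * {classic V}) := [set p | adj p.1 p.2 /\ (W p.1 \/ W p.2)].
have [NE HNE] : exists NE : R, (\esum_(p in EP) 1 <= NE%:E)%E.
  have ? : (0 <= \esum_(p in EP) (1 : \bar R))%E by exact: esum_ge0.
  by exists (fine (\esum_(p in EP) 1)%E); rewrite fineK // ge0_fin_numE.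
suff : (\esum_(t in trails adj E setT) (F (size t.1.2))%:E < +oo)%E by rewrite Hoo.
rewrite (esumID [set t : Trail V | t.1.2 = [::]]); last by move=> t _; rewrite lee_fin.
apply: lte_add_pinfty.
  apply: le_lt_trans edges_lty.
  apply: (@esum_code_le _ _ _ _ _ (fun p : {classic V} * {classic V} =>
      ((p.1 : V), ([::] : seq V), (p.2 : V)) : Trail V)).
  move=> [[a s] b] [[/= [_ _ _] Eab _] sE]; exists (a, b).
  rewrite /= in sE; subst s; rewrite /F /= expr0 mul1r expr1n; split=> //.
  exact: (incident_edges_pair Eab).
(* A trail with [n.+1] vertices consists of an oriented edge at [W], a self-avoiding walk of [n]
   steps from the head of that edge, and a final neighbour. *)
apply: (@le_lt_trans _ _ (\esum_(e in EP `*`` (fun e => [set: nat] `*``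
     (fun n => saws adj n e.2 `*`` (fun s => [set b : {classic V} | adj (last (e.2 : V) s) b]))))
     (F e.2.1.+1)%:E)).
  apply: (@esum_code_le _ _ _ _ _ (fun e : ({classic V} * {classic V}) *
      (nat * (Vseq V * {classic V})) =>
      ((e.1.1 : V), ((e.1.2 : V) :: e.2.2.1 : seq V), (e.2.2.2 : V)) : Trail V)).
  move=> [[a s] b] [[/= [walk nodup _] Eab _] sE].
  case: s walk nodup Eab sE => // v s walk nodup Eab _.
  exists ((a, v), (size s, (s, b))); split=> //; split=> /=.
    exact: (incident_edges_pair Eab).
  split=> //=; move: walk; rewrite is_walk_rcons => -[[_ walk] lb].
  by split.
apply: (@le_lt_trans _ _ (G * NE)%:E); last by rewrite ltry.
apply: (@le_trans _ _ (\esum_(p in EP) G%:E)); last exact: esum_le_cst.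
apply: esum_dep_le => [e|e _]; first by rewrite lee_fin.
apply: le_trans HG.
apply: esum_dep_le => [e'|n _]; first by rewrite lee_fin.
apply: (@le_trans _ _ (F n.+1 * D * sg n e.2)%:E); last by rewrite lee_fin.
apply: (@le_trans _ _ (\esum_(s in saws adj n e.2) (F n.+1 * D)%:E)); last first.
  apply: esum_le_cst => //; first by rewrite mulr_ge0.
  by rewrite /sg -(saw_countE degree_le).
apply: esum_dep_le => [e'|s _]; first by rewrite lee_fin.
by apply: esum_le_cst => //=; exact: degree_le.
Qed.

End Hammersley.

(** * Convergence of the roots by spreading deficiency *)

Section RootLimit.
Import numFieldNormedType.Exports.
Context {R : realType} (V : Type) (adj : V -> V -> Prop).
Variables (sg : nat -> V -> R) (W : set V) (C0 mu : R) (k : nat).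
Hypothesis mu_gt0 : 0 < mu.
Hypothesis C0_gt0 : 0 < C0.
Hypothesis adj_connected : graph_connected adj.
Hypothesis W_finite : finite_set W.
Hypothesis sg_ge0 : forall n v, 0 <= sg n v.
Hypothesis sg_add : forall m n v B, (forall u, sg n u <= B) ->
  sg (m + n)%N v <= sg m v * B.
Hypothesis sg_adj : forall u v n, adj u v ->
  sg n u <= sg n.+1 v + \sum_(j < n.+1) sg j v * sg (n - j)%N v.
Hypothesis sg_dom : forall u, exists2 w, W w & forall n, sg n u <= sg n w.
Hypothesis sg_poly : forall n u, sg n u <= C0 * n.+1%:R ^+ k * mu ^+ n.
Hypothesis sg_low : forall th m, 0 < th < 1 -> (0 < m)%N ->
  ~ (forall u, sg m u <= (th * mu) ^+ m).
Hypothesis adj_sym : forall u v, adj u v -> adj v u.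

Lemma sg_exp_le (rho : R) : 1 < rho ->
  exists2 C, 0 < C & forall n u, sg n u <= C * (rho * mu) ^+ n.
Proof.
move=> rho1; have rho0 : 0 < rho by apply: lt_trans rho1.
have r01 : 0 <= rho^-1 < 1 by rewrite invr_ge0 ltW //= invf_lt1.
have [B B0 HB] := poly_geometric_bounded k r01.
exists (C0 * B); first exact: mulr_gt0.
move=> n u; apply: (le_trans (sg_poly n u)).
rewrite exprMn mulrA; apply: ler_wpM2r; first by rewrite exprn_ge0 // ltW.
rewrite -mulrA; apply: ler_wpM2l; first exact: ltW.
by have := HB n; rewrite exprVn ler_pdivrMr // exprn_gt0.
Qed.

(* A walk of length [2n] from [u] through [v] is made of two walks from [v], one
   of length at least [n], which extends one of the few walks of length [n]. *)
Lemma deficient_step (v u : V) (th : R) : adj v u \/ v = u -> 0 < th < 1 ->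
  exists th', 0 < th' < 1 /\ exists N, forall n, (N <= n)%N ->
    sg n v <= (th * mu) ^+ n -> sg (2 * n)%N u <= (th' * mu) ^+ (2 * n).
Proof.
move=> vu /andP[th0 th1].
(* Each midpoint pays for one loss: [tau] for the growth rate [rho * mu] in place of [mu], [sig] for
   the linear factor [A * n.+1], and [th'] for the doubled length, through [sig <= th' ^+ 2]. *)
pose tau := (1 + th) / 2; pose sig := (1 + tau) / 2; pose th' := (1 + sig) / 2.
have tau0 : 0 < tau by rewrite /tau; lra.
have tau1 : tau < 1 by rewrite /tau; lra.
have sig0 : 0 < sig by rewrite /sig; lra.
have sig1 : sig < 1 by rewrite /sig; lra.
have sig_th' : sig <= th' ^+ 2 by rewrite /th' expr2; nra.
have th'0 : 0 < th' by rewrite /th'; lra.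
have th'1 : th' < 1 by rewrite /th'; lra.
pose rho := tau / th.
have rho1 : 1 < rho by rewrite /rho ltr_pdivlMr // mul1r /tau; lra.
have rho0 : 0 < rho by apply: lt_trans rho1.
have thrho : th * rho = tau by rewrite /rho mulrC divfK // gt_eqF.
clearbody rho.
have [C C_gt0 HC] := sg_exp_le rho1.
(* The deficient factor [th ^+ n] persists at every length [j] beyond [n]. *)
have late n j : sg n v <= (th * mu) ^+ n -> (n <= j)%N ->
    sg j v <= C * th ^+ n * rho ^+ (j - n) * mu ^+ j.
  move=> Hn nj; rewrite -{1}(subnKC nj).
  apply: (le_trans (sg_add n v (HC (j - n)%N))).
  have -> : C * th ^+ n * rho ^+ (j - n) * mu ^+ j =
     (th * mu) ^+ n * (C * (rho * mu) ^+ (j - n)).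
    have -> : mu ^+ j = mu ^+ n * mu ^+ (j - n) by rewrite -exprD subnKC.
    by rewrite !exprMn; ring.
  apply: ler_wpM2r => //; apply: mulr_ge0; first exact: ltW.
  by apply: exprn_ge0; apply: mulr_ge0; exact: ltW.
(* The terms cover the walks of length [2 * n + 1] from [v], the at most [2 * n + 1] split terms,
   and the case [v = u]. *)
pose A := C * rho * mu + 1 + 2 * C ^+ 2 + C.
have [N HN] : exists N, forall n, (N <= n)%N -> A * n.+1%:R * (tau / sig) ^+ n <= 1.
  apply: poly_geometric_small; apply/andP; split; first by rewrite divr_ge0 // ltW.
  by rewrite ltr_pdivrMr // mul1r /sig; lra.
exists th'; split; first by apply/andP.
exists N => n Nn Hn.
have key : sg (2 * n)%N u <= A * n.+1%:R * tau ^+ n * mu ^+ (2 * n).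
  have tn0 : 0 < tau ^+ n by rewrite exprn_gt0.
  have m2n0 : 0 < mu ^+ (2 * n) by rewrite exprn_gt0.
  have n1 : 1 <= n.+1%:R :> R by rewrite ler1n.
  have C20 : 0 < C ^+ 2 by rewrite exprn_gt0.
  have rm0 : 0 < C * rho * mu by rewrite !mulr_gt0.
  case: vu => [vu|<-]; last first.
    have := late n (2 * n)%N Hn; rewrite leq_pmull // => /(_ isT).
    have -> : (2 * n - n = n)%N by clear; lia.
    move=> /le_trans; apply; apply: ler_wpM2r; first exact: ltW.
    rewrite -mulrA -exprMn thrho; apply: ler_wpM2r; first exact: ltW.
    rewrite /A; nra.
  apply: (le_trans (sg_adj (2 * n) (adj_sym vu))).
  have first : sg (2 * n).+1 v <= C * rho * mu * (tau ^+ n * mu ^+ (2 * n)).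
    apply: (le_trans (late n (2 * n).+1 Hn _)); first by clear; lia.
    have -> : ((2 * n).+1 - n = n.+1)%N by clear; lia.
    by rewrite -thrho exprMn !exprS le_eqVlt; apply/orP; left; apply/eqP; ring.
  have term (j : 'I_(2 * n).+1) :
      sg j v * sg (2 * n - j)%N v <= C ^+ 2 * (tau ^+ n * mu ^+ (2 * n)).
    have aux i i' : (n <= i)%N -> (i + i' = 2 * n)%N ->
        sg i v * sg i' v <= C ^+ 2 * (tau ^+ n * mu ^+ (2 * n)).
      move=> ni ii'; have H1 := late n i Hn ni; have H2 := HC i' v.
      apply: (le_trans (ler_pM (sg_ge0 i v) (sg_ge0 i' v) H1 H2)).
      have -> : C * th ^+ n * rho ^+ (i - n) * mu ^+ i * (C * (rho * mu) ^+ i') =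
        C ^+ 2 * (th ^+ n * rho ^+ (i - n + i') * mu ^+ (i + i')).
        by rewrite !exprD exprMn; ring.
      (* The powers of [rho] add up to exactly [n], whatever the split, so they combine with
         [th ^+ n] into [tau ^+ n]. *)
      have -> : (i - n + i' = n)%N by clear -ni ii'; lia.
      by rewrite ii' -exprMn thrho.
    have jn := ltn_ord j; have [nj|jn'] := leqP n j; first by apply: aux => //; clear -jn; lia.
    by rewrite mulrC; apply: aux; clear -jn jn'; lia.
  have sum_le : \sum_(j < (2 * n).+1) sg j v * sg (2 * n - j)%N v <=
      (2 * n).+1%:R * (C ^+ 2 * (tau ^+ n * mu ^+ (2 * n))).
    apply: (@le_trans _ _ (\sum_(j < (2 * n).+1) C ^+ 2 * (tau ^+ n * mu ^+ (2 * n)))).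
      by apply: ler_sum => j _; exact: term.
    by rewrite sumr_const card_ord mulr_natl.
  apply: (le_trans (lerD first sum_le)).
  have -> : A * n.+1%:R * tau ^+ n * mu ^+ (2 * n) =
     A * n.+1%:R * (tau ^+ n * mu ^+ (2 * n)) by rewrite !mulrA.
  set X := tau ^+ n * mu ^+ (2 * n).
  have X0 : 0 <= X by rewrite mulr_ge0 // ltW.
  rewrite mulrA -mulrDl; apply: ler_wpM2r => //.
  have -> : (2 * n).+1%:R = 2 * n.+1%:R - 1 :> R.
    by rewrite -(natr1 (2 * n)) -(natr1 n) natrM; ring.
  by rewrite /A; nra.
apply: (le_trans key); rewrite [(th' * mu) ^+ _]exprMn; apply: ler_wpM2r; first by rewrite exprn_ge0 // ltW.
apply: (@le_trans _ _ (sig ^+ n)).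
  have := HN _ Nn; rewrite expr_div_n mulrA ler_pdivrMr ?exprn_gt0 // mul1r //.
by rewrite exprM; apply: lerXn2r; rewrite ?nnegrE ?exprn_ge0 // ltW.
Qed.

(** Steps that stay in place pad the path to exactly [d] rounds, so that vertices at different
    distances become deficient at the same length. *)
Lemma deficient_path (d : nat) (v : V) (s : seq V) (th : R) :
  is_walk adj (v :: s) -> (size s <= d)%N -> 0 < th < 1 ->
  exists th', 0 < th' < 1 /\ exists N, forall n, (N <= n)%N ->
    sg n v <= (th * mu) ^+ n ->
    sg (2 ^ d * n)%N (last v s) <= (th' * mu) ^+ (2 ^ d * n).
Proof.
elim: d v s th => [|d IH] v s th walk sz th01.
  by case: s walk sz => // _ _; exists th; split=> //; exists 0%N => n _; rewrite expn0 mul1n.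
have [u [s' [vu walk' sz' <-]]] : exists u s',
    [/\ adj v u \/ v = u, is_walk adj (u :: s'), (size s' <= d)%N & last u s' = last v s].
  case: s walk sz => [|u s] walk sz; first by exists v, [::]; split=> //; right.
  by case: walk => vu walk; exists u, s; split=> //; left.
have [th1 [th101 [N1 H1]]] := deficient_step vu th01.
have [th2 [th201 [N2 H2]]] := IH u s' th1 walk' sz' th101.
exists th2; split=> //; exists (maxn N1 N2) => n; rewrite geq_max => /andP[n1 n2] Hn.
have -> : (2 ^ d.+1 * n = 2 ^ d * (2 * n))%N by rewrite expnS -mulnA mulnCA.
by apply: H2; [clear -n2; lia|apply: H1].
Qed.

Lemma deficient_all (v : V) (th : R) : 0 < th < 1 ->
  exists d th', 0 < th' < 1 /\ exists N, forall n, (N <= n)%N ->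
    sg n v <= (th * mu) ^+ n ->
    forall u, sg (2 ^ d * n)%N u <= (th' * mu) ^+ (2 ^ d * n).
Proof.
move=> th01.
(* A threshold [d0], rather than a single [d], lets the depths required by different vertices of [W]
   be merged. *)
suff H (l : seq {classic V}) : exists d0, forall d, (d0 <= d)%N -> exists th', 0 < th' < 1 /\
    exists N, forall n, (N <= n)%N -> sg n v <= (th * mu) ^+ n ->
    forall w, w \in l -> sg (2 ^ d * n)%N w <= (th' * mu) ^+ (2 ^ d * n).
  have /finite_seqP[l Wl] : finite_set (W : set {classic V}) by exact: W_finite.
  have [d /(_ d (leqnn d))[th' [th'01 [N HN]]]] := H l.
  exists d, th'; split=> //; exists N => n Nn Hn u.
  have [w Ww Huw] := sg_dom u; apply: (le_trans (Huw _)).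
  by apply: (HN n Nn Hn w); have : [set` l] w by rewrite -Wl.
elim: l => [|w l [d0 IH]].
  by exists 0%N => d _; exists th; split=> //; exists 0%N.
have [s [walk lst]] := adj_connected v w.
exists (maxn d0 (size s)) => d; rewrite geq_max => /andP[/IH{IH}[th1 [th101 [N1 H1]]] sd].
have [th2 [th201 [N2 H2]]] := deficient_path walk sd th01.
rewrite lst in H2.
have mono (a b : R) m : 0 < a -> a <= b -> (a * mu) ^+ m <= (b * mu) ^+ m.
  move=> a0 ab; have b0 := lt_le_trans a0 ab.
  apply: lerXn2r; rewrite ?nnegrE ?ler_pM2r //; apply: mulr_ge0; exact: ltW.
have [/andP[a0 a1] /andP[b0 b1]] := (th101, th201).
exists (Num.max th1 th2); split; first by rewrite lt_max a0 gt_max a1 b1.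
exists (maxn N1 N2) => n; rewrite geq_max => /andP[n1 n2] Hn x.
rewrite in_cons => /orP[/eqP ->|xl].
  by apply: (le_trans (H2 n n2 Hn)); apply: mono; rewrite // le_max lexx orbT.
by apply: (le_trans (H1 n n1 Hn x xl)); apply: mono; rewrite // le_max lexx.
Qed.

(** A deficiency of [v] at one large length would spread to every vertex, against [sg_low]. *)
Lemma sg_eventually_ge (v : V) (th : R) : 0 < th < 1 ->
  exists N, forall n, (N <= n)%N -> (th * mu) ^+ n <= sg n v.
Proof.
move=> th01; have [d [th' [th'01 [N HN]]]] := deficient_all v th01.
exists N.+1 => n Nn; rewrite leNgt; apply/negP => /ltW Hn.
apply: (sg_low th'01 (m := (2 ^ d * n)%N)).
  by rewrite muln_gt0 expn_gt0 /=; clear -Nn; lia.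
by apply: HN => //; clear -Nn; lia.
Qed.

Lemma sg_eventually_le (rho : R) : 1 < rho ->
  exists N, forall n, (N <= n)%N -> forall v, sg n v <= (rho * mu) ^+ n.
Proof.
(* The rate halfway between 1 and [rho] leaves geometric room for the constant [C]. *)
move=> rho1; have rho'1 : 1 < (1 + rho) / 2 by lra.
have [C C_gt0 HC] := sg_exp_le rho'1.
have [N HN] : exists N, forall n, (N <= n)%N -> C * n.+1%:R * ((1 + rho) / 2 / rho) ^+ n <= 1.
  apply: poly_geometric_small; apply/andP; split; first by rewrite divr_ge0; lra.
  by rewrite ltr_pdivrMr; lra.
exists N => n /HN Hn v; apply: (le_trans (HC n v)).
rewrite !exprMn mulrA; apply: ler_wpM2r; first by rewrite exprn_ge0 // ltW.
have rn0 : 0 < rho ^+ n by rewrite exprn_gt0; lra.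
move: Hn; rewrite expr_div_n mulrA ler_pdivrMr // mul1r; apply: le_trans.
have : 0 <= C * (((1 + rho) / 2) ^+ n) by rewrite mulr_ge0 ?exprn_ge0; lra.
rewrite -exprMn mulrAC => H; rewrite -[leLHS]mulr1; apply: ler_wpM2l => //.
by rewrite ler1n.
Qed.

Lemma powR_root (a : R) (n : nat) : 0 <= a -> (0 < n)%N -> (a ^+ n) `^ n%:R^-1 = a.
Proof.
move=> a0 n0; rewrite -powR_mulrn // -powRrM mulfV ?powRr1 //.
by rewrite pnatr_eq0 -lt0n.
Qed.

Lemma sg_root_cvg (v : V) : (fun n => sg n v `^ n%:R^-1) @ \oo --> mu.
Proof.
apply/cvgrPdist_le => /= e e0.
(* The bound [1 / 2] keeps [1 - d] strictly between 0 and 1. *)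
pose d := Num.min (e / mu) (1 / 2).
have d0 : 0 < d by rewrite lt_min divr_gt0 //=; lra.
have d1 : d <= 1 / 2 by rewrite ge_min lexx orbT.
have dmu : d * mu <= e by rewrite -ler_pdivlMr // ge_min lexx.
clearbody d.
have th01 : 0 < 1 - d < 1 by apply/andP; split; lra.
have rho1 : 1 < 1 + d by lra.
have [N1 H1] := sg_eventually_ge v th01.
have [N2 H2] := sg_eventually_le rho1.
exists (maxn (maxn N1 N2) 1) => // n /=; rewrite !geq_max => /andP[/andP[n1 n2] n0].
have lo0 : 0 <= (1 - d) * mu by rewrite mulr_ge0 // ?(ltW mu_gt0) // subr_ge0; lra.
have hi0 : 0 <= (1 + d) * mu by rewrite mulr_ge0 ?(ltW mu_gt0) // addr_ge0 // ltW.
have lo : (1 - d) * mu <= sg n v `^ n%:R^-1.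
  rewrite -[leLHS](powR_root lo0 n0).
  by apply: ge0_ler_powR; rewrite ?nnegrE ?invr_ge0 ?exprn_ge0 // H1.
have hi : sg n v `^ n%:R^-1 <= (1 + d) * mu.
  rewrite -[leRHS](powR_root hi0 n0).
  by apply: ge0_ler_powR; rewrite ?nnegrE ?invr_ge0 ?exprn_ge0 // H2.
by rewrite ler_norml; apply/andP; split; lra.
Qed.

End RootLimit.

(** * Power weights and the connective constant *)

Section ConnConst.
Import numFieldNormedType.Exports.
Context {R : realType} (V : Type) (adj : V -> V -> Prop).

Definition len_weight (y : R) (n : nat) : R := if n == 0%N then 1 else n%:R `^ y.

Lemma len_weight_gt0 y n : 0 < len_weight y n.
Proof. by rewrite /len_weight; case: n => //= n; rewrite powR_gt0. Qed.

(** The convention at length 0 becomes a power of a positive base, to which [powR_comparable]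
    applies. *)
Lemma len_weightE y n : len_weight y n = (maxn n 1)%:R `^ y.
Proof. by rewrite /len_weight; case: n => [|n]; rewrite /= ?powR1 // maxnC. Qed.

(** The sign of [y] decides which of the two comparisons of [a] and [b] is used; [K] is raised to
    the absolute value to serve both cases. *)
Lemma powR_comparable (y K a b : R) : 0 < K -> 0 < a -> 0 < b ->
  a <= K * b -> b <= K * a -> a `^ y <= K `^ `|y| * b `^ y.
Proof.
move=> /ltW K0 a0 b0 ab ba; have [y0|y0] := leP 0 y.
  rewrite ger0_norm // -powRM ?(ltW b0) //.
  by apply: ge0_ler_powR => //; rewrite nnegrE ?mulr_ge0 // ltW.
rewrite ltr0_norm //; have z0 : 0 <= - y by rewrite oppr_ge0 ltW.
rewrite -{1 3}[y]opprK; move: (- y) z0 => z z0.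
rewrite !(powRN _ z) ler_pdivlMr ?powR_gt0 // mulrC ler_pdivrMr ?powR_gt0 //.
rewrite -powRM ?(ltW a0) //; apply: ge0_ler_powR; rewrite ?nnegrE ?mulr_ge0 // ltW //.
Qed.

Lemma len_weight_comparable (y : R) (K m n : nat) : (0 < K)%N ->
  (maxn m 1 <= K * maxn n 1)%N -> (maxn n 1 <= K * maxn m 1)%N ->
  len_weight y m <= K%:R `^ `|y| * len_weight y n.
Proof.
move=> K0 mn nm; rewrite !len_weightE; apply: powR_comparable.
- by rewrite ltr0n.
- by rewrite ltr0n leq_max orbT.
- by rewrite ltr0n leq_max orbT.
- by rewrite -natrM ler_nat.
- by rewrite -natrM ler_nat.
Qed.

Lemma len_weight_poly (y : R) (k n : nat) : `|y| <= k%:R ->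
  (n.+1%:R ^+ k)^-1 <= (len_weight y n)^-1 <= n.+1%:R ^+ k.
Proof.
move=> yk; have n1 : (1 : R) <= n.+1%:R by rewrite ler1n.
have n0 : (0 : R) < n.+1%:R by [].
have max_le : (maxn n 1 <= n.+1)%N by rewrite geq_max leqnSn.
have w0 := len_weight_gt0 y n; have p0 : 0 < n.+1%:R ^+ k :> R by rewrite exprn_gt0.
have step : n.+1%:R `^ `|y| <= n.+1%:R ^+ k :> R.
  by rewrite -powR_mulrn //; apply: ler_powR.
have eq0 : len_weight y 0 = 1 by [].
have up : len_weight y n <= n.+1%:R ^+ k.
  have := @len_weight_comparable y n.+1 n 0 isT; rewrite eq0 mulr1 muln1 => H.
  apply: le_trans step; apply: H => //.
  by apply: (@leq_trans (maxn n 1)); [rewrite leq_max orbT|rewrite leq_pmull].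
have lo : 1 <= n.+1%:R ^+ k * len_weight y n.
  have := @len_weight_comparable y n.+1 0 n isT; rewrite eq0 => H.
  apply: le_trans (H _ _) _.
  - by apply: (@leq_trans (maxn n 1)); [rewrite leq_max orbT|rewrite leq_pmull].
  - by rewrite muln1.
  by apply: ler_wpM2r => //; exact: ltW.
apply/andP; split; first by rewrite lef_pV2.
by rewrite -[leLHS]mul1r ler_pdivrMr.
Qed.

Lemma Sigma_midwalks (W : set V) :
  Sigma adj W = midwalks adj (incident_edges adj W) setT.
Proof. by rewrite predeqE => p; split=> [[? ?]|[? [? _]]]; split. Qed.

Lemma YfunE (W : set V) (x y : R) : Yfun adj W x y =
  (\esum_(p in midwalks adj (incident_edges adj W) setT)
     (x ^+ wlen p / len_weight y (wlen p))%:E)%E.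
Proof. by rewrite /Yfun Sigma_midwalks. Qed.

Lemma Yfun_trails_le (W : set V) (x y : R) : simple_graph adj ->
  (Yfun adj W x y <= \esum_(t in trails adj (incident_edges adj W) setT)
     (x ^+ size t.1.2 / len_weight y (size t.1.2))%:E)%E.
Proof.
move=> adj_simple; rewrite YfunE.
exact: (esum_midwalks_le adj_simple _ _ (fun n => x ^+ n / len_weight y n)).
Qed.

Lemma trails_Yfun_lty (W : set V) (x y : R) : simple_graph adj -> 0 <= x ->
  (Yfun adj W x y < +oo)%E ->
  (\esum_(t in trails adj (incident_edges adj W) setT)
     (x ^+ size t.1.2 / len_weight y (size t.1.2))%:E < +oo)%E.
Proof.
move=> adj_simple x0; rewrite YfunE => Hlty.
have F0 n : 0 <= x ^+ n / len_weight y n.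
  by rewrite divr_ge0 ?exprn_ge0 // ltW // len_weight_gt0.
apply: (le_lt_trans (esum_trails_le adj_simple _ _ F0)); apply: lte_mul_pinfty => //.
  by apply: esum_ge0 => p _; rewrite lee_fin F0.
  rewrite ge0_fin_numE //; by apply: esum_ge0 => p _; rewrite lee_fin F0.
by apply: esum_finite_lty => [|//|b _]; [exact: finite_finset|rewrite ltry].
Qed.

(* Hammersley's theorem; the hypotheses on [Yfun] say that [x] is the radius of
   convergence, up to polynomial factors. *)
Theorem conn_const_radius (D : R) (W : set V) (x y1 y2 : R) :
  simple_graph adj ->
  (forall v, (\esum_(u in [set u : {classic V} | adj v u]) 1 <= D%:E)%E) ->
  graph_connected adj -> fundamental_domain adj W -> 0 < x ->
  Yfun adj W x y1 = +oo%E -> (Yfun adj W x y2 < +oo)%E ->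
  forall v, conn_const adj v = x^-1.
Proof.
move=> adj_simple degree_le connected W_dom x0 Y1 Y2 v.
(* [k.+1] dominates both exponents in absolute value, so both weights lie between inverse and direct
   integer powers of [n.+1]. *)
pose k := Num.truncn (`|y1| + `|y2|).
have kle : `|y1| + `|y2| <= k.+1%:R by rewrite ltW // truncnS_gt.
have k1 : `|y1| <= k.+1%:R by apply: le_trans kle; rewrite lerDl.
have k2 : `|y2| <= k.+1%:R by apply: le_trans kle; rewrite lerDr.
have xn n : 0 <= x ^+ n by rewrite exprn_ge0 // ltW.
have Hinf : (\esum_(t in trails adj (incident_edges adj W) setT)
    (x ^+ size t.1.2 * (size t.1.2).+1%:R ^+ k.+1)%:E = +oo)%E.
  apply/eqP; rewrite -leye_eq -Y1; apply: (le_trans (Yfun_trails_le W x y1 adj_simple)).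
  apply: le_esum => t _; rewrite lee_fin; apply: ler_wpM2l => //.
  by case/andP: (len_weight_poly (size t.1.2) k1).
have Hfin : (\esum_(t in trails adj (incident_edges adj W) setT)
    (x ^+ size t.1.2 / (size t.1.2).+1%:R ^+ k.+1)%:E < +oo)%E.
  apply: le_lt_trans (trails_Yfun_lty adj_simple (ltW x0) Y2).
  apply: le_esum => t _; rewrite lee_fin; apply: ler_wpM2l => //.
  by case/andP: (len_weight_poly (size t.1.2) k2).
have [C C0 HC] := saw_nb_poly_le degree_le W_dom x0 Hfin.
have [sym _] := adj_simple.
rewrite /conn_const; apply: cvg_lim; first exact: Rhausdorff.
apply: (@sg_root_cvg R V adj (fun n v => saw_nb adj n v) W C x^-1 k.+1) => //.
- by rewrite invr_gt0.
- by case: W_dom.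
- by move=> n u; exact: saw_nb_ge0.
- by move=> m n u B; exact: (saw_nb_add degree_le).
- by move=> u w n; exact: (saw_nb_adj adj_simple degree_le).
- have [_ H] := W_dom; move=> u; have [f [f_aut Wfu]] := H u.
  by exists (f u) => // n; exact: (saw_nb_aut degree_le).
- by move=> th m; exact: (saw_nb_not_deficient adj_simple degree_le W_dom x0 Hinf).
Qed.

End ConnConst.

(** * Gadgets and lifts *)

Section GadgetPaths.
Context {R : realType} (U : finType) (eH : rel U) (P : {set U}).
Implicit Types (p q : U) (s : seq U).

(** Both ends belong to the list, so its size is the number of vertices that the path adds to a
    walk. *)
Definition gpath p q s : bool :=
  if s is x :: s' then [&& x == p, path eH x s', uniq s & last x s' == q] else false.

Definition gpath_sum (x : R) p q : \bar R :=
  (\esum_(s in [set s | gpath p q s]) (x ^+ size s)%:E)%E.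

Lemma gpath_uniq p q s : gpath p q s -> uniq s.
Proof. by case: s => //= x s /and4P[]. Qed.

Lemma uniq_size s : uniq s -> (size s <= #|U|)%N.
Proof. by move=> /card_uniqP <-; exact: max_card. Qed.

Lemma gpath_size p q s : gpath p q s -> (0 < size s <= #|U|)%N.
Proof. by move=> H; rewrite (uniq_size (gpath_uniq H)) andbT; case: s H. Qed.

Lemma finite_size_le n : finite_set [set s : seq U | (size s <= n)%N].
Proof.
apply: (@sub_finite_set _ _
  ((fun k : {i : 'I_n.+1 & i.-tuple U} => val (tagged k)) @` setT)); last first.
  exact/finite_image/finite_finset.
move=> s /= sn; by exists (existT (fun i : 'I_n.+1 => i.-tuple U : Type)
  (Ordinal (sn : size s < n.+1)%N) (in_tuple s)).
Qed.

Lemma gpath_finite p q : finite_set [set s | gpath p q s].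
Proof.
by apply: sub_finite_set (finite_size_le #|U|) => s /gpath_size /andP[].
Qed.

Lemma gpath_map (f : {perm U}) p q s :
  (forall x y, eH (f x) (f y) = eH x y) -> gpath p q s -> gpath (f p) (f q) (map f s).
Proof.
move=> fe; case: s => //= x s /and4P[/eqP -> walk /andP[nps us] /eqP <-].
rewrite eqxx path_map last_map eqxx andbT /=.
rewrite mem_map ?map_inj_uniq ?nps ?us ?andbT; try exact: perm_inj.
by rewrite (eq_path (e' := eH)) // => y z /=; rewrite fe.
Qed.

Lemma gpath_rev p q s : symmetric eH -> gpath p q s -> gpath q p (rev s).
Proof.
move=> sym; case: s => //= x s /and4P[/eqP -> walk us /eqP <-].
have := rev_path eH p s; rewrite (eq_path (e' := eH)); last by move=> y z; exact: sym.
rewrite walk => {}walk.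
case/lastP: s us walk => [|s z] us walk; first by rewrite /= eqxx.
rewrite last_rcons belast_rcons in walk *.
have : uniq (z :: rcons (rev s) p) by rewrite -rcons_cons -rev_rcons -rev_cons rev_uniq.
rewrite rev_cons in walk.
by rewrite rev_cons rev_rcons /= eqxx last_rcons eqxx walk => /= ->.
Qed.

Lemma gpath_exists p q : (forall x y, connect eH x y) -> exists s, gpath p q s.
Proof.
move=> /(_ p q)/connectP[s walk lst].
case/shortenP: walk lst => s' walk' us' _ lst.
by exists (p :: s'); rewrite /= eqxx walk' -lst eqxx andbT /=.
Qed.

Hypothesis ok : gadget_ok eH P.

Lemma gpath_sum_le_gen (x : R) p q p' q' : 0 <= x -> p \in P -> q \in P -> p != q ->
  p' \in P -> q' \in P -> p' != q' ->
  (gpath_sum x p q <= gpath_sum x p' q')%E.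
Proof.
have [sym irr con card3 [S [HS trans]]] := ok.
move=> x0 pP qP pq p'P q'P pq'.
have third a b : a \in P -> b \in P -> a != b ->
    exists c, [/\ c \in P, c != a, c != b & forall d, d \in P -> [|| d == a, d == b | d == c]].
  move=> aP bP ab; have : #|P :\ a :\ b| = 1%N.
    have := cardsD1 a P; have := cardsD1 b (P :\ a).
    by rewrite card3 aP in_setD1 bP eq_sym ab /=; lia.
  move=> /eqP/cards1P[c cE].
  have : c \in P :\ a :\ b by rewrite cE set11.
  rewrite !in_setD1 => /and3P[cb ca cP]; exists c; split=> // d dP.
  case: (eqVneq d a) => //= da; case: (eqVneq d b) => //= db.
  by have : d \in P :\ a :\ b; [rewrite !in_setD1 da db|rewrite cE finset.in_set1].
(* An unordered pair of ports is determined by the third port, and the gadget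
   symmetries are transitive on ports; reversal swaps the ends of a path. *)
have [r [rP rp rq _]] := third _ _ pP qP pq.
have [r' [r'P rp' rq' all']] := third _ _ p'P q'P pq'.
have [f fS fr] := trans _ _ rP r'P; have [fe fP] := HS _ fS.
have fin a : a \in P -> f a \in P by move=> aP; rewrite -fP mem_imset //; exact: perm_inj.
have in2 a : a \in P -> a != r -> (f a == p') || (f a == q').
  move=> aP ar; have := all' _ (fin _ aP); rewrite -fr.
  by rewrite (inj_eq perm_inj) (negPf ar) orbF.
rewrite eq_sym in rp; rewrite eq_sym in rq.
have fpq : f p != f q by rewrite (inj_eq perm_inj).
have size_le (h : seq U -> seq U) : injective h -> (forall s, size (h s) = size s) ->
   (forall s, gpath p q s -> gpath p' q' (h s)) ->
   (gpath_sum x p q <= gpath_sum x p' q')%E.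
  move=> hinj hsize hpath; apply: (@esum_inj_le _ _ _ _ _ h) => //.
    by move=> s t _ _ /hinj.
  by move=> s _; rewrite hsize.
have [/eqP fp|fp'] := orP (in2 _ pP rp).
  have fq : f q = q'.
    by have := in2 _ qP rq; rewrite -fp eq_sym (negPf fpq) /= => /eqP.
  apply: (size_le (map f)); first exact/inj_map/perm_inj.
    by move=> s; rewrite size_map.
  by move=> s /(gpath_map fe); rewrite fp fq.
move/eqP: fp' => fp.
have fq : f q = p'.
  by have := in2 _ qP rq; rewrite -fp [_ == f p]eq_sym (negPf fpq) orbF => /eqP.
apply: (size_le (fun s => rev (map f s))).
- by move=> s t /(can_inj revK)/(inj_map (@perm_inj _ f)).
- by move=> s; rewrite size_rev size_map.
- by move=> s /(gpath_map fe)/(gpath_rev sym); rewrite fp fq.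
Qed.

Lemma gpath_sum_port (x : R) p q p' q' : 0 <= x -> p \in P -> q \in P -> p != q ->
  p' \in P -> q' \in P -> p' != q' -> gpath_sum x p q = gpath_sum x p' q'.
Proof. by move=> *; apply/eqP; rewrite eq_le !gpath_sum_le_gen. Qed.

(** The sum is a polynomial in [x]. It vanishes at 0, because a path has at least one vertex, and at
    [Num.max 1 y] a single path already contributes at least [y]; the intermediate value theorem
    concludes. *)
Lemma gpath_sum_onto (y : R) p q : 0 < y ->
  exists2 x, 0 < x & gpath_sum x p q = y%:E.
Proof.
move=> y0; have [_ _ con _ _] := ok.
have [s0 s0P] := gpath_exists p q con.
have /finite_seqP[F0 FE] := gpath_finite p q; pose F := undup F0.
have inF s : (s \in F) = gpath p q s.
  have E : (s \in F0 : Prop) = gpath p q s by rewrite -[LHS]/([set` F0] s) -FE.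
  by rewrite mem_undup; apply/idP/idP; rewrite E.
have {}FE : [set s | gpath p q s] = [set` F].
  by rewrite predeqE => s /=; rewrite inF.
have HE x : 0 <= x -> gpath_sum x p q = (\sum_(s <- F) x ^+ size s)%:E.
  move=> x0; rewrite /gpath_sum esum_fset; [|exact: gpath_finite|].
    by rewrite FE -fsbig_seq ?undup_uniq // sumEFin.
  by move=> s _; rewrite lee_fin exprn_ge0.
pose h : {poly R} := \sum_(s <- F) 'X^(size s).
have hE x : h.[x] = \sum_(s <- F) x ^+ size s.
  by rewrite /h horner_sum; apply: eq_bigr => s _; rewrite hornerXn.
have h0 : h.[0] = 0.
  rewrite hE big_seq big1 // => s; rewrite inF => /gpath_size/andP[s1 _].
  by rewrite expr0n gtn_eqF.
pose b := Num.max 1 y.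
have b1 : 1 <= b by rewrite le_max lexx.
have hb : y <= h.[b].
  rewrite hE (bigD1_seq s0) ?inF ?undup_uniq //=.
  apply: (@le_trans _ _ (b ^+ size s0)); last first.
    by rewrite lerDl sumr_ge0 // => s _; rewrite exprn_ge0 // (le_trans _ b1).
  apply: (@le_trans _ _ b); first by rewrite le_max lexx orbT.
  by have /andP[? _] := gpath_size s0P; apply: ler_eXnr.
have [|x /andP[x0 xb]] := @poly_ivt R (h - y%:P) 0 b (le_trans ler01 b1).
  by rewrite !hornerE h0 sub0r oppr_le0 (ltW y0) subr_ge0 hb.
rewrite /root !hornerE subr_eq0 => /eqP hx.
exists x; last by rewrite HE // -hE hx.
rewrite lt_neqAle x0 andbT; apply/eqP => x00.
by move: hx; rewrite -x00 h0 => y00; rewrite -y00 ltxx in y0.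
Qed.

End GadgetPaths.

(** * Lifts of a base walk to the transformed graph *)

Section Lifting.
Context {R : realType}.
Variables (V0 : Type) (adj0 : V0 -> V0 -> Prop).
Variables (U : finType) (eH : rel U) (P : {set U}) (port : V0 -> V0 -> U).
Hypothesis adj0_simple : simple_graph adj0.
Hypothesis ok : gadget_ok eH P.
Hypothesis lab : port_labelling adj0 P port.
Let adj1 := phi_adj adj0 eH port.
Let V1 := (V0 * U)%type.
Implicit Types (a b u v w : V0) (s : seq V0) (qs : seq (seq U)).

Let sym0 u v : adj0 u v -> adj0 v u. Proof. exact: (proj1 adj0_simple). Qed.
Let irr0 v : ~ adj0 v v. Proof. exact: (proj2 adj0_simple). Qed.

Lemma adj_neq u v : adj0 u v -> u <> v.
Proof. by move=> uv E; apply: (irr0 (v := v)); rewrite -{1}E. Qed.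

Lemma phi_adj_simple : simple_graph adj1.
Proof.
have [sym irr _ _ _] := ok; split.
  move=> [u x] [v y] [[/= -> xy]|[/= uv [-> ->]]]; [left|right]; split=> //=.
    by rewrite sym.
  exact: sym0.
by move=> [u x] [[/= _ xx]|[/= /irr0]] //; move: (irr x); rewrite xx.
Qed.

(* A lift of the walk [a :: s ++ [:: b]] chooses, in the gadget of each vertex of
   [s], a self-avoiding path between the ports at which the walk enters and leaves. *)
Fixpoint lifts a s b qs : Prop :=
  match s, qs with
  | [::], [::] => True
  | v :: s', q :: qs' => gpath eH (port v a) (port v (head b s')) q /\ lifts v s' b qs'
  | _, _ => False
  end.

Fixpoint lift_verts s qs : seq V1 :=
  match s, qs with
  | v :: s', q :: qs' => map (pair v) q ++ lift_verts s' qs'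
  | _, _ => [::]
  end.

Definition cross u w : set V1 := [set (u, port u w); (w, port w u)].

Lemma crossC u w : cross u w = cross w u.
Proof. by rewrite /cross setUC. Qed.

Lemma cross_set2 u w u' w' : [set u; w] = [set u'; w'] -> cross u w = cross u' w'.
Proof. by move=> E; have [[-> ->]//|[-> ->]] := set2_eq E; rewrite crossC. Qed.

Lemma cross_inj u w u' w' : cross u w = cross u' w' -> [set u; w] = [set u'; w'].
Proof. by move=> E; have [[[-> _] [-> _]]//|[[-> _] [-> _]]] := set2_eq E; rewrite setUC. Qed.

(** Each visited gadget contributes at least one vertex and, its path being self-avoiding, at most
    [#|U|]. *)
Lemma lifts_size a s b qs : lifts a s b qs ->
  (size s <= size (lift_verts s qs) <= #|U| * size s)%N.
Proof.
elim: s a qs => [|v s IH] a [|q qs] //= [/gpath_size /andP[q1 qU] /IH /andP[lo hi]].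
rewrite size_cat size_map mulnS; apply/andP; split; last exact: leq_add.
by rewrite -add1n; exact: leq_add.
Qed.

Lemma port_neq v u w : adj0 v u -> adj0 v w -> u <> w -> port v u != port v w.
Proof.
move=> vu vw uw; have [_ inj _] := lab v.
by apply/eqP => /(inj _ _ vu vw).
Qed.

Lemma is_walk_glue (T : Type) (adj : T -> T -> Prop) (x : T) (l r : seq T) :
  is_walk adj (x :: l ++ r) = (is_walk adj (x :: l) /\ is_walk adj (last x l :: r)).
Proof.
have [l' E] := last_split x l.
by rewrite -cat_cons E -catA cat1s is_walk_cat.
Qed.

Lemma inner_edges_glue (T : Type) (x : T) (l r : seq T) :
  inner_edges (x :: l ++ r) = inner_edges (x :: l) ++ inner_edges (last x l :: r).
Proof.
have [l' E] := last_split x l.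
by rewrite -cat_cons E -catA cat1s inner_edges_cat.
Qed.

Lemma last_map_pair v p (q : seq U) : last (v, p) (map (pair v) q) = (v, last p q).
Proof. by elim: q p => //= x q IH p. Qed.

Lemma is_walk_fiber v (q : seq U) p : path eH p q -> is_walk adj1 (map (pair v) (p :: q)).
Proof.
elim: q p => [//|x q IH] p /= /andP[px /IH H]; split=> //; by left.
Qed.

Lemma lift_walk a s b qs : is_walk adj0 (a :: s ++ [:: b]) -> lifts a s b qs ->
  is_walk adj1 ((a, port a (head b s)) :: lift_verts s qs ++ [:: (b, port b (last a s))]).
Proof.
elim: s a qs => [|v s IH] a [|q qs] //=.
  by move=> [ab _] _; split=> //; right.
move=> [av walk] [+ L]; case: q => [//|x q] /and4P[/eqP -> pq _ /eqP lq].
split; first by right.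
rewrite -catA is_walk_glue; split; first exact: (is_walk_fiber v pq).
by rewrite last_map_pair lq; exact: IH.
Qed.

Lemma lift_first a s b qs : lifts a s b qs ->
  head (b, port b (last a s)) (lift_verts s qs) = (head b s, port (head b s) a).
Proof.
case: s qs => [|v s] [|q qs] //= [+ _].
by case: q => [//|x q] /and4P[/eqP ->].
Qed.

Lemma lift_last a s b qs : lifts a s b qs ->
  last (a, port a (head b s)) (lift_verts s qs) = (last a s, port (last a s) b).
Proof.
elim: s a qs => [|v s IH] a [|q qs] //= [+ /IH]; rewrite last_cat.
by case: q => [//|x q] /and4P[_ _ _ /eqP lq]; rewrite /= last_map_pair lq.
Qed.

Lemma lift_verts_fst s qs (z : V1) : List.In z (lift_verts s qs) -> List.In z.1 s.
Proof.
elim: s qs => [|v s IH] [|q qs] //= /List.in_app_iff[/List.in_map_iff[x [<- _]]|/IH]; auto.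
Qed.

Lemma in_map_pair v (q : seq U) (z : V1) : List.In z (map (pair v) q) -> z.1 = v.
Proof. by elim: q => //= x q IH [<-|/IH]. Qed.

Lemma NoDup_fiber v (q : seq U) : uniq q -> List.NoDup (map (pair v) q).
Proof.
elim: q => [|x q IH] /=; first by move=> _; constructor.
move=> /andP[xq /IH H]; constructor=> // /List.in_map_iff[y [[->] yq]].
move/negP: xq; apply; elim: q {IH H} yq => //= z q IH [->|/IH]; rewrite in_cons ?eqxx //.
by move=> ->; rewrite orbT.
Qed.

Lemma lift_nodup a s b qs : List.NoDup s -> lifts a s b qs ->
  List.NoDup (lift_verts s qs).
Proof.
elim: s a qs => [|v s IH] a [|q qs] //=; first by move=> _ _; constructor.
move=> /List.NoDup_cons_iff[vs nodup] [/gpath_uniq uq /(IH _ _ nodup) H].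
apply: List.NoDup_app => //; first exact: NoDup_fiber.
by move=> z /in_map_pair zv /lift_verts_fst; rewrite zv.
Qed.

Lemma inner_edge_adj (T : Type) (adj : T -> T -> Prop) (l : seq T) (e : set T) :
  is_walk adj l -> List.In e (inner_edges l) -> exists x y, adj x y /\ e = [set x; y].
Proof.
elim: l => [//|x [//|y l] IH] [xy walk] /= [<-|He]; first by exists x, y.
exact: IH.
Qed.

(** The edges of a lift are of two kinds, those above an edge of the base walk and those inside one
    visited gadget. Of the second kind only the gadget is recorded, which is enough to tell edges
    apart below. *)
Lemma lift_edges_in a s b qs (e : set V1) : is_walk adj0 (a :: s ++ [:: b]) ->
  lifts a s b qs ->
  List.In e (inner_edges
    ((a, port a (head b s)) :: lift_verts s qs ++ [:: (b, port b (last a s))])) ->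
  (exists u w, [/\ adj0 u w, e = cross u w &
     List.In [set u; w] (inner_edges (a :: s ++ [:: b]))]) \/
  (exists v x, [/\ List.In v s, e (v, x) & forall z, e z -> z.1 = v]).
Proof.
elim: s a qs => [|v s IH] a [|q qs] //.
  by move=> [ab _] _ /= [<-|//]; left; exists a, b; split=> //; left.
move=> [av walk] [+ L]; case: q => [//|x q] /and4P[/eqP -> pq _ /eqP lq].
rewrite /= -catA.
have := @inner_edges_glue _ (v, port v a) (map (pair v) q)
   (lift_verts s qs ++ [:: (b, port b (last v s))]).
rewrite last_map_pair lq /= => -> [<-|].
  by left; exists a, v; split=> //; left.
move=> /List.in_app_iff[He|/(IH v qs walk L)[[u [w [uw eE H]]]|[v' [y [v's ev fib]]]]].
- right; exists v.
  have walkq := is_walk_fiber v pq.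
  have [z [z' [zz' eE]]] := inner_edge_adj walkq He.
  have fib z0 : e z0 -> z0.1 = v.
    by move=> ez; exact: in_map_pair (@in_inner_edges _ (map (pair v) (port v a :: q)) e z0 He ez).
  have ez : e z by rewrite eE; left.
  exists z.2; split=> //; first by left.
  by rewrite -(fib z ez) -surjective_pairing.
- by left; exists u, w; split=> //; right.
- by right; exists v', y; split=> //; right.
Qed.

(** Crossing edges inherit distinctness from the base edges through [cross_inj]; inner edges lie on
    self-avoiding paths in different gadgets. *)
Lemma lift_edges_nodup a s b qs : is_walk adj0 (a :: s ++ [:: b]) ->
  List.NoDup s -> List.NoDup (inner_edges (a :: s ++ [:: b])) -> lifts a s b qs ->
  List.NoDup (inner_edges
    ((a, port a (head b s)) :: lift_verts s qs ++ [:: (b, port b (last a s))])).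
Proof.
elim: s a qs => [|v s IH] a [|q qs] //.
  by move=> *; constructor=> //; constructor.
move=> [av walk] /List.NoDup_cons_iff[vs nodup] /List.NoDup_cons_iff[ave nodupe] [+ L].
have {IH} nodup' := IH v qs walk nodup nodupe L.
have in' := fun e => @lift_edges_in v s b qs e walk L.
case: q => [//|x q] /and4P[/eqP -> pq uq /eqP lq].
rewrite /= -catA.
have := @inner_edges_glue _ (v, port v a) (map (pair v) q)
   (lift_verts s qs ++ [:: (b, port b (last v s))]).
rewrite last_map_pair lq /= => ->.
have fib (e : set V1) z : List.In e (inner_edges (map (pair v) (port v a :: q))) ->
    e z -> z.1 = v.
  move=> He ez; exact: in_map_pair (@in_inner_edges _ (map (pair v) (port v a :: q)) e z He ez).
have cross_l u w : cross u w (u, port u w) by left.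
have cross_r u w : cross u w (w, port w u) by right.
constructor.
  move=> /List.in_app_iff[He|/in'[[u [w [uw eE H]]]|[v' [y [v's ev fibv]]]]].
  - by apply: (adj_neq av); exact: (fib _ _ He (cross_l a v)).
  - by apply: ave; rewrite (cross_inj eE).
  - have /= av' := fibv _ (cross_l a v); have /= vv' := fibv _ (cross_r a v).
    by apply: (adj_neq av); rewrite av' vv'.
apply: List.NoDup_app => //.
  exact: (NoDup_inner_edges (NoDup_fiber v uq)).
move=> e He /in'[[u [w [uw eE H]]]|[v' [y [v's ev fibv]]]].
  apply: (adj_neq uw); rewrite eE in He.
  by have /= uv := fib _ _ He (cross_l u w); have /= wv := fib _ _ He (cross_r u w); rewrite uv wv.
by apply: vs; have /= vv' := fib _ _ He ev; rewrite -vv'.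
Qed.

Definition lift_trail (t : Trail V0) qs : Trail V1 :=
  ((t.1.1, port t.1.1 (head t.2 t.1.2)), lift_verts t.1.2 qs, (t.2, port t.2 (last t.1.1 t.1.2))).

Lemma lift_trailP (t : Trail V0) qs : trail adj0 t.1.1 t.1.2 t.2 ->
  lifts t.1.1 t.1.2 t.2 qs ->
  [/\ trail adj1 (lift_trail t qs).1.1 (lift_trail t qs).1.2 (lift_trail t qs).2,
      first_edge (lift_trail t qs).1.1 (lift_trail t qs).1.2 (lift_trail t qs).2 =
        cross t.1.1 (head t.2 t.1.2) &
      last_edge (lift_trail t qs).1.1 (lift_trail t qs).1.2 (lift_trail t qs).2 =
        cross (last t.1.1 t.1.2) t.2].
Proof.
case: t => [[a s] b] [walk nodup nodupe] /= L; split.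
- by split; [exact: lift_walk|exact: lift_nodup L|exact: lift_edges_nodup].
- by rewrite /first_edge /= lift_first.
- by rewrite /last_edge /= lift_last.
Qed.

(** The first change of the base coordinate shows where the leading gadget path ends. In a lift,
    consecutive gadgets differ because adjacent base vertices do. *)
Lemma fiber_cat_inj v (q q' : seq U) (r r' : seq V1) : 
  (forall z, ohead r = Some z -> z.1 <> v) -> (forall z, ohead r' = Some z -> z.1 <> v) ->
  map (pair v) q ++ r = map (pair v) q' ++ r' -> q = q' /\ r = r'.
Proof.
move=> rv rv'; elim: q q' => [|x q IH] [|x' q'] //=.
- by move=> E; have := rv (v, x'); rewrite E => /(_ erefl).
- by move=> E; have := rv' (v, x); rewrite -E => /(_ erefl).
- by move=> [-> /IH[-> ->]].
Qed.

Lemma lift_verts_inj a s b qs s' qs' :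
  is_walk adj0 (a :: s ++ [:: b]) -> is_walk adj0 (a :: s' ++ [:: b]) ->
  lifts a s b qs -> lifts a s' b qs' -> lift_verts s qs = lift_verts s' qs' ->
  s = s' /\ qs = qs'.
Proof.
have head_fst c l ps : lifts c l b ps -> is_walk adj0 (c :: l ++ [:: b]) ->
    forall z, ohead (lift_verts l ps) = Some z -> z.1 <> c.
  case: l ps => [|u l] [|q ps] //= [+ _] [cu _] z.
  by case: q => [//|x q] _ /= [<-] /= uc; exact: (adj_neq cu).
elim: s a qs s' qs' => [|v s IH] a [|q qs] [|v' s'] [|q' qs'] //=.
- by move=> _ _ _ [+ _]; case: q'.
- by move=> _ _ [+ _]; case: q.
move=> [av walk] [av' walk'] [gq L] [gq' L'] E.
have Ev : v = v'.
  by case: q gq E => [//|x q] _; case: q' gq' => [//|x' q'] _ /= [].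
subst v'.
have [-> E'] := fiber_cat_inj (head_fst _ _ _ L walk) (head_fst _ _ _ L' walk') E.
by have [-> ->] := IH _ _ _ _ walk walk' L L' E'.
Qed.

Variables (x h : R).
Hypothesis x_gt0 : 0 < x.
Hypothesis h_ge0 : 0 <= h.
Hypothesis gsum : forall p q, p \in P -> q \in P -> p != q -> gpath_sum eH x p q = h%:E.

(** The gadget paths are chosen independently and lengths add up, so the sum factors, with one
    factor [h] for each vertex of [s]. *)
Lemma lifts_sum a s b : is_walk adj0 (a :: s ++ [:: b]) ->
  List.NoDup (inner_edges (a :: s ++ [:: b])) ->
  (\esum_(qs in [set qs | lifts a s b qs]) (x ^+ size (lift_verts s qs))%:E =
   (h ^+ size s)%:E)%E.
Proof.
have x0 := ltW x_gt0.
elim: s a => [|v s IH] a walk nodup.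
  rewrite (_ : [set qs | _] = [set [::]]).
    by rewrite esum_set1 ?lee_fin.
  by rewrite predeqE => -[|q qs]; split.
case: (walk) => av walk'; have nodup' : List.NoDup (inner_edges (v :: s ++ [:: b])).
  by case/List.NoDup_cons_iff: nodup.
(* A trail does not leave [v] by the edge through which it came, so the entry and exit ports differ
   and [gsum] applies. *)
have [va vh ah] : [/\ adj0 v a, adj0 v (head b s) & a <> head b s].
  split; first exact: sym0.
    by case: s walk' {walk nodup IH nodup'} => [|? ?] [].
  move=> E; case/List.NoDup_cons_iff: nodup => + _; apply.
  by case: s E {walk nodup' IH walk'} => [|? ?] /= ->; left; rewrite setUC.
have [[pP _ _] _] := (lab v, lab v).
set Q := [set q | gpath eH (port v a) (port v (head b s)) q].
set L := [set qs | lifts v s b qs].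
rewrite (@reindex_esum _ _ _ (Q `*` L) _ (fun k => k.1 :: k.2)); last first.
  split.
  - by move=> [q qs] [].
  - by move=> [q qs] [q' qs'] _ _ /= [-> ->].
  - by move=> [|q qs] //= [gq Lq]; exists (q, qs).
transitivity (\esum_(k in Q `*` L) ((x ^+ size k.1)%:E * (x ^+ size (lift_verts s k.2))%:E))%E.
  by apply: eq_esum => -[q qs] _ /=; rewrite size_cat size_map exprD EFinM.
rewrite (@esum_setX _ _ _ _ _ (fun q => x ^+ size q)
   (fun qs => (x ^+ size (lift_verts s qs))%:E)); first last.
- by move=> qs; rewrite lee_fin exprn_ge0.
- by move=> q; rewrite exprn_ge0.
rewrite (IH v walk' nodup').
under eq_esum do rewrite muleC.
rewrite esumZl ?exprn_ge0 //; last by move=> q; rewrite lee_fin exprn_ge0.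
have := gsum (pP _ va) (pP _ vh) (port_neq va vh ah); rewrite /gpath_sum => ->.
by rewrite -EFinM exprS mulrC.
Qed.

End Lifting.

(** * Contraction of walks and comparison of trail sums *)

Section Comparison.
Context {R : realType}.
Variables (V0 : Type) (adj0 : V0 -> V0 -> Prop).
Variables (U : finType) (eH : rel U) (P : {set U}) (port : V0 -> V0 -> U).
Hypothesis adj0_simple : simple_graph adj0.
Hypothesis adj0_cubic : cubic adj0.
Hypothesis ok : gadget_ok eH P.
Hypothesis lab : port_labelling adj0 P port.
Let adj1 := phi_adj adj0 eH port.
Let V1 := (V0 * U)%type.
Implicit Types (a b u v w : V0) (s : seq V0) (qs : seq (seq U)).

(* A walk [c :: s1 ++ [:: d]] of the transformed graph that leaves its first gadget:
   after [c] it traverses [qf] inside the gadget of [c], then the lift [qs] of [s],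
   then [ql] inside the gadget of [d]. *)
Record run_decomposition (c d : V1) (s1 : seq V1) (qf : seq U) s qs (ql : seq U) : Prop := {
  run_eq : s1 = map (pair c.1) qf ++ lift_verts s qs ++ map (pair d.1) ql;
  run_walk : is_walk adj0 (c.1 :: s ++ [:: d.1]);
  run_edges : List.NoDup (inner_edges (c.1 :: s ++ [:: d.1]));
  run_lifts : lifts eH port c.1 s d.1 qs;
  run_path : path eH c.2 qf;
  run_exit : last c.2 qf = port c.1 (head d.1 s);
  run_uniq : uniq qf;
  run_uniq_last : uniq ql;
  run_cross : forall u w, List.In [set u; w] (inner_edges (c.1 :: s ++ [:: d.1])) ->
    List.In (cross port u w) (inner_edges (c :: s1 ++ [:: d]));
  run_first : (head d s1).1 <> c.1 -> head d.1 s = (head d s1).1;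
  run_last : (last c s1).1 <> d.1 -> last c.1 s = (last c s1).1 }.

Lemma NoDup_pair_uniq v (q : seq U) : List.NoDup (map (pair v) q) -> uniq q.
Proof.
elim: q => //= x q IH /List.NoDup_cons_iff[xq /IH ->]; rewrite andbT.
apply/negP => xq'; apply: xq; elim: q xq' {IH} => //= y q IH.
by rewrite in_cons => /orP[/eqP ->|/IH]; [left|right].
Qed.

Lemma mem_In_pair v x (q : seq U) : x \in q -> List.In (v, x) (map (pair v) q).
Proof.
by elim: q => //= y q IH; rewrite in_cons => /orP[/eqP ->|/IH]; [left|right].
Qed.

(** Induction from the left. A step inside the gadget of [c] lengthens [qf]; a crossing step turns
    [qf], with its entry vertex, into the path through the gadget just entered, and starts a new
    empty [qf]. [run_cross] is what carries the absence of repeated edges down to the contracted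
    walk, and [run_first] and [run_last] identify the base edge below an extreme edge that
    crosses. *)
Lemma run_decompositionP (c d : V1) (s1 : seq V1) :
  is_walk adj1 (c :: s1 ++ [:: d]) -> List.NoDup s1 ->
  List.NoDup (inner_edges (c :: s1 ++ [:: d])) ->
  (c.1 = d.1 /\ exists q, s1 = map (pair c.1) q) \/
  (exists qf s qs ql, run_decomposition c d s1 qf s qs ql).
Proof.
elim: s1 c => [|c' s1 IH] c.
  move=> [[[cd _]|[cd [c2 d2]]] _] _ nodupe; first by left; split=> //; exists [::].
  right; exists [::], [::], [::], [::]; split=> //=.
  - by constructor=> //; constructor.
  - move=> u w [E|//]; left; rewrite -(cross_set2 _ E) /cross -c2 -d2.
    by rewrite -!surjective_pairing.
move=> [cc' walk] /List.NoDup_cons_iff[c's1 nodup] /List.NoDup_cons_iff[ce nodupe].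
case: (IH c' walk nodup nodupe) => {IH} [[c'd [q s1E]]|[qf [s [qs [ql D]]]]].
  have s1E' : c' :: s1 = map (pair c'.1) (c'.2 :: q).
    by rewrite s1E /= -surjective_pairing.
  case: cc' => [[cc' _]|[cc' [c2 c'2]]].
    by left; split; [rewrite cc'|exists (c'.2 :: q); rewrite cc'].
  right; exists [::], [::], [::], (c'.2 :: q); split=> //=.
  - by rewrite -c'd; exact: s1E'.
  - by split=> //; rewrite -c'd.
  - by constructor=> //; constructor.
  - by rewrite -c'd.
  - by apply: (@NoDup_pair_uniq c'.1 (c'.2 :: q)); rewrite -s1E'; constructor.
  - move=> u w [E|//]; left; rewrite -(cross_set2 _ E) /cross -c'd -c2 -c'2.
    by rewrite -!surjective_pairing.
  - have := last_map_pair c'.1 c'.2 q.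
    by rewrite -surjective_pairing s1E => -> /=.
case: cc' => [[cc' cc'2]|[cc' [c2 c'2]]].
  right; exists (c'.2 :: qf), s, qs, ql; case: D => D1 D2 D3 D4 D5 D6 D7 D8 D9 D10 D11.
  split; rewrite ?cc' //.
  - by rewrite D1 /= -surjective_pairing.
  - by rewrite /= cc'2.
  - rewrite /= D7 andbT; apply/negP => /(mem_In_pair c'.1).
    rewrite -surjective_pairing => H; apply: c's1; rewrite D1.
    by apply/List.in_app_iff; left.
  - by move=> u w /D9 H; right.
case: D => D1 D2 D3 D4 D5 D6 D7 D8 D9 D10 D11.
right; exists [::], (c'.1 :: s), ((c'.2 :: qf) :: qs), ql.
have set_cc' : cross port c.1 c'.1 = [set c; c'].
  by rewrite /cross -c2 -c'2 -!surjective_pairing.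
split=> //=.
- by rewrite D1 -surjective_pairing -!catA.
- constructor=> // /D9; rewrite set_cc'; exact: ce.
- split=> //; rewrite -c'2 eqxx D5 D6 eqxx andbT /= D7 andbT.
  apply/negP => /(mem_In_pair c'.1).
  rewrite -surjective_pairing => H; apply: c's1; rewrite D1.
  by apply/List.in_app_iff; left.
- by move=> u w [E|/D9 H]; [left; rewrite -(cross_set2 _ E)|right].
Qed.

Variables (x h : R).
Hypothesis x_gt0 : 0 < x.
Hypothesis h_ge0 : 0 <= h.
Hypothesis gsum : forall p q, p \in P -> q \in P -> p != q -> gpath_sum eH x p q = h%:E.

(** The power of [x] uses the length of the lift but the power weight uses the base length. With
    this mixture, summing over the lifts of a fixed trail gives exactly the base term at [h]. *)
Definition lift_weight (y : R) (t : Trail V0) qs : R :=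
  x ^+ size (lift_verts t.1.2 qs) / len_weight y (size t.1.2).

Lemma lift_weight_ge0 y t qs : 0 <= lift_weight y t qs.
Proof. by rewrite divr_ge0 ?exprn_ge0 ?(ltW x_gt0) // ltW // len_weight_gt0. Qed.

Lemma trails_lifts_sum (E E' : set (set V0)) (y : R) :
  (\esum_(t in trails adj0 E E') (h ^+ size t.1.2 / len_weight y (size t.1.2))%:E =
   \esum_(k in trails adj0 E E' `*`` (fun t => [set qs | lifts eH port t.1.1 t.1.2 t.2 qs]))
     (lift_weight y k.1 k.2)%:E)%E.
Proof.
rewrite -(@esum_esum _ _ _ _ _ (fun t qs => (lift_weight y t qs)%:E)); last first.
  by move=> t qs _ _; rewrite lee_fin lift_weight_ge0.
apply: eq_esum => -[[a s] b] [[/= walk _ nodup] _ _].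
rewrite mulrC EFinM -(lifts_sum adj0_simple lab x_gt0 h_ge0 gsum walk nodup) -esumZl.
- by apply: eq_esum => qs _; rewrite -EFinM mulrC.
- by rewrite invr_ge0 ltW // len_weight_gt0.
- by move=> qs; rewrite lee_fin exprn_ge0 // ltW.
Qed.

Lemma card_gadget_gt0 : (0 < #|U|)%N.
Proof.
have [_ _ _ card3 _] := ok; apply: (@leq_trans #|P|); first by rewrite card3.
exact: max_card.
Qed.

(** Lifting is injective by [lift_verts_inj], and multiplies nonzero lengths by a factor between 1
    and [#|U|], whence the constant. *)
Lemma trails_lift_le (E E' : set (set V0)) (F F' : set (set V1)) (y : R) :
  (forall u w, adj0 u w -> E [set u; w] -> F (cross port u w)) ->
  (forall u w, adj0 u w -> E' [set u; w] -> F' (cross port u w)) ->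
  (\esum_(t in trails adj0 E E') (h ^+ size t.1.2 / len_weight y (size t.1.2))%:E <=
   (#|U|%:R `^ `|y|)%:E * \esum_(t in trails adj1 F F')
      (x ^+ size t.1.2 / len_weight y (size t.1.2))%:E)%E.
Proof.
move=> EF EF'; rewrite trails_lifts_sum -esumZl; last 2 first.
- exact: powR_ge0.
- by move=> t; rewrite lee_fin divr_ge0 ?exprn_ge0 ?ltW // len_weight_gt0.
apply: (@esum_inj_le _ _ _ _ _
  (fun k : Trail V0 * seq (seq U) => lift_trail port k.1 k.2)).
- move=> [[[a s] b] qs] [[/= T Ea Eb] L].
  have [T' e1 e2] := @lift_trailP _ _ _ _ _ adj0_simple (a, s, b) qs T L.
  case: T => walk _ _; split; first exact: T'.
    rewrite [first_edge _ _ _]e1.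
    by apply: EF => //; case: s walk {L T' e1 e2 Ea Eb} => [|v s] [].
  by rewrite [last_edge _ _ _]e2; apply: EF' => //; move: walk; rewrite is_walk_rcons => -[].
- move=> [[[a s] b] qs] [[[a' s'] b'] qs'] [[/= T _ _] L] [[/= T' _ _] L'].
  rewrite /lift_trail /= => -[Ea _ El Eb _]; subst a' b'.
  case: T T' => walk _ _ [walk' _ _].
  by have [-> ->] := lift_verts_inj adj0_simple walk walk' L L' El.
- move=> [[[a s] b] qs] [_ /= L]; rewrite -EFinM lee_fin /lift_weight /=.
  have /andP[lo hi] := lifts_size L; have U0 := card_gadget_gt0.
  rewrite mulrCA; apply: ler_wpM2l; first by rewrite exprn_ge0 // ltW.
  have w1 := len_weight_gt0 y (size s).
  have w2 := len_weight_gt0 y (size (lift_verts s qs)).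
  rewrite ler_pdivlMr // mulrC ler_pdivrMr //.
  apply: len_weight_comparable => //.
    rewrite geq_max; apply/andP; split.
      apply: (leq_trans hi); rewrite leq_mul2l leq_max leqnn orbT //.
    by rewrite muln_gt0 U0 leq_max orbT.
  rewrite geq_max; apply/andP; split.
    apply: (leq_trans lo); apply: (@leq_trans (maxn (size (lift_verts s qs)) 1)).
      by rewrite leq_max leqnn.
    by rewrite leq_pmull.
  by rewrite muln_gt0 U0 leq_max orbT.
Qed.

Definition within_gadget : set (Trail V1) :=
  [set t | t.1.1.1 = t.2.1 /\ exists q, t.1.2 = map (pair t.1.1.1) q].

(** [C] precedes the edge sets, since eta needs one constant for all automorphisms. In the
    conditions on these sets, an edge inside the gadget of [c] only says that the base walk ends at
    some edge of [c.1], whereas a crossing edge determines the base edge. *)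
Lemma trails_lift_ge (y : R) : exists2 C : R, 0 <= C &
  forall (E E' : set (set V0)) (F F' : set (set V1)),
  (forall c d w, adj1 c d -> F [set c; d] -> adj0 c.1 w -> (d.1 <> c.1 -> w = d.1) ->
     E [set c.1; w]) ->
  (forall c d w, adj1 c d -> F' [set c; d] -> adj0 c.1 w -> (d.1 <> c.1 -> w = d.1) ->
     E' [set c.1; w]) ->
  (\esum_(t in trails adj1 F F' `&` ~` within_gadget)
      (x ^+ size t.1.2 / len_weight y (size t.1.2))%:E <=
   C%:E * \esum_(t in trails adj0 E E') (h ^+ size t.1.2 / len_weight y (size t.1.2))%:E)%E.
Proof.
have x0 := ltW x_gt0; have U0 := card_gadget_gt0.
(* What contraction forgets besides the lift: the gadget coordinates of both outer ends and the
   partial paths in the two extreme gadgets. There are finitely many possibilities. *)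
pose FF : set ((U * seq U) * (seq U * U)) :=
  [set f | (size f.1.2 <= #|U|)%N /\ (size f.2.1 <= #|U|)%N].
have finFF : finite_set FF.
  apply: (@sub_finite_set _ _ (([set: U] `*` [set s : seq U | (size s <= #|U|)%N]) `*`
     ([set s : seq U | (size s <= #|U|)%N] `*` [set: U]))).
    by move=> [[u q] [q' u']] [].
  by apply: finite_setX; apply: finite_setX; (exact: finite_finset || exact: finite_size_le).
have [N N0 HN] := @esum_cst_le R _ FF 1 finFF ler01.
(* [X] bounds the weight of the two partial paths for [x] on either side of 1. The constant [K]
   below bounds the change of length: two partial paths and the lift have at most
   [3 * #|U| * maxn n 1] vertices. *)
pose X := Num.max 1 x ^+ (#|U| + #|U|).
pose K := (3 * #|U|)%N; have K0 : (0 < K)%N by rewrite muln_gt0.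
pose C1 := X * K%:R `^ `|y|.
have X0 : 0 <= X by rewrite exprn_ge0 // le_max ler01.
have C10 : 0 <= C1 by rewrite mulr_ge0 // powR_ge0.
exists (C1 * N); first exact: mulr_ge0.
move=> E E' F F' EF EF'; rewrite trails_lifts_sum.
set TL := (_ `*`` _).
apply: (@le_trans _ _ (\esum_(k in TL `*` FF) ((C1 * lift_weight y k.1.1 k.1.2)%:E * 1))%E);
    last first.
  rewrite (@esum_setX _ _ _ _ _ (fun k => C1 * lift_weight y k.1 k.2) (fun=> 1%E)) //; last first.
    by move=> k; rewrite mulr_ge0 // lift_weight_ge0.
  rewrite -esumZl ?mulr_ge0 //; last by move=> k; rewrite lee_fin lift_weight_ge0.
  apply: le_esum => k _.
  have -> : ((C1 * N)%:E * (lift_weight y k.1 k.2)%:E =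
      (C1 * lift_weight y k.1 k.2)%:E * N%:E)%E.
    by rewrite -!EFinM; congr EFin; ring.
  apply: lee_pmul; [|exact: esum_ge0|by []|exact: HN].
  by rewrite lee_fin mulr_ge0 // lift_weight_ge0.
apply: (@esum_code_le _ _ _ _ _
  (fun k : (Trail V0 * seq (seq U)) * ((U * seq U) * (seq U * U)) =>
   (((k.1.1.1.1, k.2.1.1) : V1),
    map (pair k.1.1.1.1) k.2.1.2 ++ lift_verts k.1.1.1.2 k.1.2 ++ map (pair k.1.1.2) k.2.2.1,
    ((k.1.1.2, k.2.2.2) : V1)) : Trail V1)).
move=> [[[c1 c2] s1] [d1 d2]] [[/= [walk nodup nodupe] Fc Fd] nW].
case: (run_decompositionP walk nodup nodupe) => [//|[qf [s [qs [ql D]]]]].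
case: D => /= D1 D2 D3 D4 D5 D6 D7 D8 D9 D10 D11.
have nodups := cubic_trail adj0_simple adj0_cubic D2 D3.
exists (((c1, s, d1), qs), ((c2, qf), (ql, d2))); split.
- split; last by split; exact: uniq_size.
  split=> //=; split=> //=.
    have ch : adj1 (c1, c2) (head (d1, d2) s1) by case: (s1) walk => [|? ?] [].
    by apply: (EF _ _ (head d1 s) ch Fc) => //; case: (s) D2 => [|? ?] [].
  have [_ /(proj1 (phi_adj_simple port adj0_simple ok)) lc] :
      is_walk adj1 ((c1, c2) :: s1) /\ adj1 (last (c1, c2) s1) (d1, d2).
    by rewrite -is_walk_rcons.
  rewrite /last_edge setUC; apply: (EF' (d1, d2) (last (c1, c2) s1)) => //=.
    by rewrite setUC.
  have [_ lb] : is_walk adj0 (c1 :: s) /\ adj0 (last c1 s) d1 by rewrite -is_walk_rcons.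
  exact: (proj1 adj0_simple).
- by rewrite /= -D1.
- rewrite mule1 lee_fin /= /lift_weight /= D1 !size_cat !size_map.
  have qfU := uniq_size D7; have qlU := uniq_size D8.
  have /andP[lo hi] := lifts_size D4.
  set L := size (lift_verts s qs) in lo hi *; set n := size s in lo hi *.
  rewrite !exprD.
  have -> : x ^+ size qf * (x ^+ L * x ^+ size ql) = x ^+ (size qf + size ql) * x ^+ L.
    by rewrite exprD; ring.
  rewrite /C1 -!mulrA; apply: ler_pM; rewrite ?exprn_ge0 //.
  + by rewrite mulr_ge0 ?exprn_ge0 // invr_ge0 ltW // len_weight_gt0.
  + apply: (@le_trans _ _ (Num.max 1 x ^+ (size qf + size ql))).
      by apply: lerXn2r; rewrite ?nnegrE // ?le_max ?ler01 // lexx orbT.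
    by apply: ler_weXn2l; [rewrite le_max lexx|exact: leq_add].
  + rewrite [leRHS]mulrCA; apply: ler_wpM2l; first by rewrite exprn_ge0.
    have w1 := len_weight_gt0 y n.
    have w2 := len_weight_gt0 y (size qf + (L + size ql)).
    rewrite ler_pdivlMr // mulrC ler_pdivrMr //.
    apply: len_weight_comparable => //; clear -lo hi qfU qlU U0; rewrite /K; nia.
Qed.

End Comparison.

(** * The transformed graph *)

Section TransformedGraph.
Context {R : realType}.
Variables (V0 : Type) (adj0 : V0 -> V0 -> Prop).
Variables (U : finType) (eH : rel U) (P : {set U}) (port : V0 -> V0 -> U).
Hypothesis adj0_simple : simple_graph adj0.
Hypothesis ok : gadget_ok eH P.
Hypothesis lab : port_labelling adj0 P port.
Let adj1 := phi_adj adj0 eH port.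
Let V1 := (V0 * U)%type.
Implicit Types (u v w : V0).

Let port_inj v w w' : adj0 v w -> adj0 v w' -> port v w = port v w' -> w = w'.
Proof. by have [_ H _] := lab v; exact: H. Qed.

(** [port v] injects the neighbours of [v] into the finite type [U]. *)
Lemma base_degree_le : exists D : R, forall v,
  (\esum_(u in [set u : {classic V0} | adj0 v u]) 1 <= D%:E)%E.
Proof.
have [D _ HD] := @esum_cst_le R _ [set: U] 1 finite_finset ler01.
exists D => v; apply: le_trans (HD (fun=> 1%E) (fun _ _ => lexx _)).
by apply: (@esum_inj_le _ _ _ _ _ (port v : {classic V0} -> U)) => // w w'; exact: port_inj.
Qed.

(* A vertex has at most one neighbour outside its gadget, hence the code [option U]. *)
Lemma phi_degree_le : exists D : R, forall v : V1,
  (\esum_(u in [set u : {classic V1} | adj1 v u]) 1 <= D%:E)%E.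
Proof.
have [D _ HD] := @esum_cst_le R _ [set: option U] 1 finite_finset ler01.
exists D => -[v x]; apply: le_trans (HD (fun=> 1%E) (fun _ _ => lexx _)).
pose code (u : V0 * U) : option U := if `[< u.1 = v >] then Some u.2 else None.
apply: (@esum_inj_le _ _ _ _ _ (code : {classic V1} -> option U)) => //; rewrite /code.
move=> [w y] [w' y'] /= [[/= <- _]|[/= vw [xw ->]]] [[/= <- _]|[/= vw' [xw' ->]]].
- by rewrite !asboolT // => -[->].
- by rewrite asboolT // asboolF // => /esym /(adj_neq adj0_simple vw').
- by rewrite asboolF ?asboolT // => /esym /(adj_neq adj0_simple vw).
- by move=> _; rewrite (port_inj vw vw') // -xw -xw'.
Qed.

Lemma phi_fundamental_domain (W0 : set V0) :
  (forall f, is_aut adj0 f -> exists g, is_aut adj1 g /\ forall a, (g a).1 = f a.1) ->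
  fundamental_domain adj0 W0 -> fundamental_domain adj1 (@gadget_domain V0 U W0).
Proof.
move=> induced [finW dom]; split.
  apply: (@sub_finite_set _ _ (W0 `*` [set: U])) => [[v x]|]; first by split.
  by apply: finite_setX => //; exact: finite_finset.
move=> [v x]; have [f [f_aut Wf]] := dom v; have [g [g_aut gf]] := induced f f_aut.
by exists g; split=> //; rewrite /gadget_domain /= gf.
Qed.

Definition image_edges (T : Type) (E : set (set T)) (f : T -> T) : set (set T) :=
  [set e | exists e', E e' /\ e = f @` e'].

Lemma image_edges_id (T : Type) (E : set (set T)) : image_edges E id = E.
Proof.
rewrite predeqE => e; split; first by move=> [e' [? ->]]; rewrite image_id.
by exists e; rewrite image_id.
Qed.

Lemma image_pair (T : Type) (f : T -> T) (a b : T) : f @` [set a; b] = [set f a; f b].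
Proof. by rewrite image_setU !image_set1. Qed.

Section InducedAutomorphism.
Variables (W0 : set V0) (f : V0 -> V0) (g : V1 -> V1).
Hypothesis f_aut : is_aut adj0 f.
Hypothesis g_aut : is_aut adj1 g.
Hypothesis gf : forall a, (g a).1 = f a.1.

Let E0 := image_edges (incident_edges adj0 W0) f.
Let E1 := image_edges (incident_edges adj1 (@gadget_domain V0 U W0)) g.
Let f_inj : injective f. Proof. exact: bij_inj (proj1 f_aut). Qed.

(** This is the edge condition of [trails_lift_le]. As [f] is injective, [g] sends a crossing edge
    to an edge between two different gadgets, which can only be the crossing edge above the
    image. *)
Lemma cross_image u w : adj0 u w -> E0 [set u; w] -> E1 (cross port u w).
Proof.
suff H a b : adj0 a b -> W0 a \/ W0 b -> E1 (cross port (f a) (f b)).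
  move=> uw [e [[[a [b [ab ->]]] [z [Wz zab]]]]]; rewrite image_pair => uwE.
  rewrite (cross_set2 port uwE); apply: H => //.
  by case: zab Wz => -> ?; [left|right].
move=> ab Wab.
have cross_adj : adj1 (a, port a b) (b, port b a) by right.
exists (cross port a b); split.
  split; first by exists (a, port a b), (b, port b a).
  by case: Wab => ?; [exists (a, port a b)|exists (b, port b a)]; split=> //; [left|right].
rewrite /cross image_pair.
have /(proj2 g_aut)[[+ _]|[_ [+ +]]] := cross_adj; rewrite !gf /=.
  by move=> /f_inj /(adj_neq adj0_simple ab).
move=> g2 g2'; congr ([set _; _]); apply: injective_projections => //=.
Qed.

(** This is the edge condition of [trails_lift_ge]. Below an edge inside a gadget, every edge at
    [c.1] is the image of one incident to [W0]; below a crossing edge, [w] is forced to be [d.1]. *)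
Lemma base_image (c d : V1) w : adj1 c d -> E1 [set c; d] -> adj0 c.1 w ->
  (d.1 <> c.1 -> w = d.1) -> E0 [set c.1; w].
Proof.
move=> cd [e [[[a [b [ab ->]]] [z [Wz zab]]]]]; rewrite image_pair => cdE cw wd.
case: ab => [[ab _]|[ab _]].
  have cE : c.1 = f a.1.
    by have [[-> _]|[-> _]] := set2_eq cdE; rewrite gf ?ab.
  have Wa : W0 a.1 by case: zab Wz => ->; rewrite /gadget_domain /= -?ab.
  have [f' f'K fK'] := proj1 f_aut.
  have aw : adj0 a.1 (f' w) by apply/(proj2 f_aut); rewrite fK' -cE.
  exists [set a.1; f' w]; split; last by rewrite image_pair fK' -cE.
  by split; [exists a.1, (f' w)|exists a.1; split=> //; left].
have cdab : [set c.1; d.1] = [set f a.1; f b.1].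
  by have [[-> ->]|[-> ->]] := set2_eq cdE; rewrite !gf // setUC.
have dc : d.1 <> c.1.
  move=> dc; have [] := adj_neq adj0_simple ab; apply: f_inj.
  by have [[<- <-]|[<- <-]] := set2_eq cdab.
rewrite (wd dc) cdab; exists [set a.1; b.1]; split; last by rewrite image_pair.
split; first by exists a.1, b.1.
by exists z.1; split=> //; case: zab => ->; [left|right].
Qed.

End InducedAutomorphism.

Lemma cross_incident (W0 : set V0) u w : adj0 u w ->
  incident_edges adj0 W0 [set u; w] ->
  incident_edges adj1 (@gadget_domain V0 U W0) (cross port u w).
Proof.
move=> uw; have := @cross_image W0 id id _ _ _ u w uw.
rewrite !image_edges_id; apply=> //.
- by split=> //; exists id.
- by split=> //; exists id.
Qed.

Lemma base_incident (W0 : set V0) (c d : V1) w : adj1 c d ->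
  incident_edges adj1 (@gadget_domain V0 U W0) [set c; d] -> adj0 c.1 w ->
  (d.1 <> c.1 -> w = d.1) -> incident_edges adj0 W0 [set c.1; w].
Proof.
move=> cd; have := @base_image W0 id id _ _ c d w cd.
rewrite !image_edges_id; apply=> //.
by split=> //; exists id.
Qed.

Lemma within_gadget_edges (t : Trail V1) : within_gadget t ->
  (forall z, first_edge t.1.1 t.1.2 t.2 z -> z.1 = t.1.1.1) /\
  (forall z, last_edge t.1.1 t.1.2 t.2 z -> z.1 = t.1.1.1).
Proof.
case: t => [[[a x] s] [b y]] [/= <- [q ->]]; split=> z.
  by move=> [->|->] //; case: q.
by move=> [->|->] //; rewrite last_map_pair.
Qed.

Lemma within_gadget_first (W0 : set V0) (F : set (set V1)) (t : Trail V1) :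
  trails adj1 (incident_edges adj1 (@gadget_domain V0 U W0)) F t -> within_gadget t ->
  W0 t.1.1.1.
Proof.
move=> [_ [_ [z [Wz tz]]] _] /within_gadget_edges[H _].
by rewrite -(H z tz).
Qed.

(** Such a trail is given by a vertex of the finite set [W0], a repetition-free list in [U] and two
    gadget coordinates. *)
Lemma within_gadget_lty (W0 : set V0) (F : set (set V1)) (G : nat -> R) :
  finite_set W0 -> (forall n, 0 <= G n) ->
  (\esum_(t in trails adj1 (incident_edges adj1 (@gadget_domain V0 U W0)) F `&` @within_gadget V0 U)
     (G (size t.1.2))%:E < +oo)%E.
Proof.
move=> finW G0.
pose FF : set ({classic V0} * (U * (seq U * U))) :=
  W0 `*` ([set: U] `*` ([set q | (size q <= #|U|)%N] `*` [set: U])).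
apply: (@le_lt_trans _ _ (\esum_(k in FF) (G (size k.2.2.1))%:E)%E).
  apply: (@esum_code_le _ _ _ _ _ (fun k : {classic V0} * (U * (seq U * U)) =>
    ((((k.1 : V0), k.2.1) : V1), map (pair (k.1 : V0)) k.2.2.1,
     (((k.1 : V0), k.2.2.2) : V1)) : Trail V1)).
  move=> t [Tt Wt]; have Wv := within_gadget_first Tt Wt.
  case: t Tt Wt Wv => [[[v x] s] [b y]] [[_ nodup _] _ _] [/= vb [q sE]] Wv.
  subst b s; exists (v, (x, (q, y))); split=> //; last by rewrite size_map.
  by split=> //; split=> //; split=> //; exact: (uniq_size (NoDup_pair_uniq nodup)).
apply: esum_finite_lty => [|k|k _]; rewrite ?lee_fin ?ltry //.
apply: finite_setX => //; apply: finite_setX; first exact: finite_finset.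
by apply: finite_setX; [exact: finite_size_le|exact: finite_finset].
Qed.

End TransformedGraph.

(** * Positivity of the connective constant *)

Section ConnConstPositive.
Import numFieldNormedType.Exports.
Context {R : realType} (V : Type) (adj : V -> V -> Prop).

Lemma conn_const_ge0 v : 0 <= conn_const adj v :> R.
Proof.
rewrite /conn_const; set u := fun n : nat => _.
(* For divergent roots the limit is the default point of [R], which is 0. *)
have [cu|/dvgP ->] := pselect (cvg (u @ \oo)); last by [].
by apply: limr_ge => //; apply: nearW => n; exact: powR_ge0.
Qed.

Lemma Yfun0_lty (D : R) (W : set V) (y : R) : simple_graph adj ->
  (forall v, (\esum_(u in [set u : {classic V} | adj v u]) 1 <= D%:E)%E) ->
  fundamental_domain adj W -> (Yfun adj W 0 y < +oo)%E.
Proof.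
move=> adj_simple degree_le W_dom.
apply: (le_lt_trans (Yfun_trails_le W 0 y adj_simple)).
have edges_lty := esum_edges_lty adj_simple degree_le W_dom.
have term n : (0 : R) ^+ n / len_weight y n = (n == 0%N)%:R.
  by case: n => [|n]; rewrite ?expr0n ?mul0r //= /len_weight eqxx divr1.
rewrite (esumID [set t : Trail V | t.1.2 = [::]]); last first.
  by move=> t _; rewrite term lee_fin.
apply: lte_add_pinfty; last first.
  rewrite esum1 ?ltry // => -[[a [|v s]] b] [_ /=] // _.
  by rewrite term.
apply: le_lt_trans edges_lty.
apply: (@esum_code_le _ _ _ _ _ (fun p : {classic V} * {classic V} =>
    ((p.1 : V), ([::] : seq V), (p.2 : V)) : Trail V)).
move=> [[a s] b] [[/= [_ _ _] Eab _] sE]; exists (a, b).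
rewrite /= in sE; subst s; rewrite term; split=> //.
exact: (incident_edges_pair adj_simple Eab).
Qed.

(** If the constant were 0, its inverse would be 0 too, and only walks visiting no vertex would
    count. Their sum is finite, against the divergence required below a finite gamma. *)
Lemma gamma_conn_const_gt0 (D g : R) (W : set V) (v : V) : simple_graph adj ->
  (forall v, (\esum_(u in [set u : {classic V} | adj v u]) 1 <= D%:E)%E) ->
  fundamental_domain adj W -> gamma_is adj W g%:E -> 0 < conn_const adj v :> R.
Proof.
move=> adj_simple degree_le W_dom gam; rewrite lt_neqAle conn_const_ge0 andbT.
apply/eqP => c0; have [+ _] := gam v (g - 1).
rewrite -c0 invr0 lte_fin => /(_ _) H.
have := Yfun0_lty (g - 1) adj_simple degree_le W_dom.
by rewrite H ?ltrBlDr ?ltrDl.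
Qed.

End ConnConstPositive.

(** * Transfer of the walk sums *)

Section Transfer.
Context {R : realType}.
Variables (V0 : Type) (adj0 : V0 -> V0 -> Prop).
Variables (U : finType) (eH : rel U) (P : {set U}) (port : V0 -> V0 -> U).
Variable (W0 : set V0).
Hypothesis adj0_simple : simple_graph adj0.
Hypothesis adj0_cubic : cubic adj0.
Hypothesis ok : gadget_ok eH P.
Hypothesis lab : port_labelling adj0 P port.
Hypothesis W0_finite : finite_set W0.
Let adj1 := phi_adj adj0 eH port.
Let V1 := (V0 * U)%type.
Let W1 : set V1 := gadget_domain W0.
Let adj1_simple : simple_graph adj1. Proof. exact: phi_adj_simple ok. Qed.

Variables (x h : R).
Hypothesis x_gt0 : 0 < x.
Hypothesis h_ge0 : 0 <= h.
Hypothesis gsum : forall p q, p \in P -> q \in P -> p != q -> gpath_sum eH x p q = h%:E.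

Let pos (y : R) n : 0 <= x ^+ n / len_weight y n.
Proof. by rewrite divr_ge0 ?exprn_ge0 // ?(ltW x_gt0) // ltW // len_weight_gt0. Qed.

Let pos_h (y : R) n : 0 <= h ^+ n / len_weight y n.
Proof. by rewrite divr_ge0 ?exprn_ge0 // ltW // len_weight_gt0. Qed.

Lemma Yfun_phi_infty y : Yfun adj0 W0 h y = +oo%E -> Yfun adj1 W1 x y = +oo%E.
Proof.
move=> Yoo; apply/eqP; rewrite -leye_eq leNgt; apply/negP => Ylty.
have lty := trails_Yfun_lty adj1_simple (ltW x_gt0) Ylty.
have := Yfun_trails_le W0 h y adj0_simple; rewrite Yoo leye_eq => /eqP too.
have := @trails_lift_le R V0 adj0 U eH P port adj0_simple ok lab x h x_gt0 h_ge0 gsum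
  (incident_edges adj0 W0) setT (incident_edges adj1 W1) setT y
  (@cross_incident _ _ _ _ _ adj0_simple W0) (fun _ _ _ _ => I).
rewrite too leye_eq => /eqP Koo; move: (ltry (1 : R)).
suff : ((#|U|%:R `^ `|y|)%:E * (\esum_(t in trails adj1 (incident_edges adj1 W1) setT)
    (x ^+ size t.1.2 / len_weight y (size t.1.2))%:E) < +oo)%E by rewrite Koo.
apply: lte_mul_pinfty => //; rewrite ?lee_fin ?powR_ge0 //.
Qed.

Lemma Yfun_phi_lty y : (Yfun adj0 W0 h y < +oo)%E -> (Yfun adj1 W1 x y < +oo)%E.
Proof.
move=> Ylty; apply: (le_lt_trans (Yfun_trails_le W1 x y adj1_simple)).
rewrite (esumID (@within_gadget V0 U)); last by move=> t _; rewrite lee_fin pos.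
apply: lte_add_pinfty.
  exact: (within_gadget_lty adj0 eH port setT W0_finite (pos y)).
have [C C0 HC] := @trails_lift_ge R V0 adj0 U eH P port adj0_simple adj0_cubic ok lab
  x h x_gt0 h_ge0 gsum y.
apply: (le_lt_trans (HC (incident_edges adj0 W0) setT (incident_edges adj1 W1) setT _ _)).
- by move=> c d w; exact: base_incident.
- by [].
apply: lte_mul_pinfty => //; first exact: (trails_Yfun_lty adj0_simple h_ge0).
Qed.

(** Inserting the trivial weight of exponent 0 makes the trail comparisons made for [Yfun] apply to
    [Zfun]. *)
Lemma ZfunE (T : Type) (adj : T -> T -> Prop) (W : set T) f (z : R) :
  Zfun adj W f z = (\esum_(p in midwalks adj (incident_edges adj W)
     (image_edges (incident_edges adj W) f)) (z ^+ wlen p / len_weight 0 (wlen p))%:E)%E.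
Proof.
rewrite /Zfun; have -> : Sigma_aut adj W f = midwalks adj (incident_edges adj W)
     (image_edges (incident_edges adj W) f).
  by rewrite predeqE => p; split=> [[[? ?] ?]|[? [? ?]]].
apply: eq_esum => p _; rewrite /len_weight powRr0.
by case: ifP => _; rewrite divr1.
Qed.

Section Automorphism.
Variables (f : V0 -> V0) (g : V1 -> V1).
Hypothesis f_aut : is_aut adj0 f.
Hypothesis g_aut : is_aut adj1 g.
Hypothesis gf : forall a, (g a).1 = f a.1.

Lemma walk_project (a b : V1) (s : seq V1) : walk_from_to adj1 a b s ->
  exists2 s', walk_from_to adj0 a.1 b.1 s' & (size s' <= size s)%N.
Proof.
elim: s a => [|c s IH] a; first by move=> [_ <-]; exists [::].
move=> [[ac walk] lst]; have [s' [walk' lst'] sz] := IH c (conj walk lst).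
case: ac => [[-> _]|[ac _]]; first by exists s' => //; exact: leqW.
by exists (c.1 :: s') => //; split.
Qed.

Lemma gadget_walk v p q : exists2 s, walk_from_to adj1 (v, p) (v, q) s & (size s <= #|U|)%N.
Proof.
have [_ _ con _ _] := ok; have [s0 H] := gpath_exists p q con.
have /andP[_ sU] := gpath_size H.
case: s0 H sU => [//|p' s] /and4P[/eqP -> ps _ /eqP lst] sU.
exists (map (pair v) s); last by rewrite size_map ltnW.
by split; [exact: is_walk_fiber ps|rewrite last_map_pair lst].
Qed.

Lemma walk_glue (T : Type) (adj : T -> T -> Prop) a b c s s' :
  walk_from_to adj a b s -> walk_from_to adj b c s' -> walk_from_to adj a c (s ++ s').
Proof.
by move=> [w1 l1] [w2 l2]; split; rewrite ?is_walk_glue ?last_cat l1.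
Qed.

(** Each base step costs one crossing and at most [#|U|] steps to the next port; the extra [#|U|]
    reaches the prescribed final vertex. *)
Lemma walk_lift u v s p q : walk_from_to adj0 u v s ->
  exists2 s', walk_from_to adj1 (u, p) (v, q) s' & (size s' <= #|U| + size s * #|U|.+1)%N.
Proof.
elim: s u p => [|w s IH] u p.
  move=> [_ /= <-]; have [s' ? ?] := gadget_walk u p q.
  by exists s'; rewrite ?mul0n ?addn0.
move=> [[uw walk] lst]; have [s' w' sz'] := IH w (port w u) (conj walk lst).
have [s0 w0 sz0] := gadget_walk u p (port u w).
exists (s0 ++ ((w, port w u) :: s')).
  apply: (walk_glue w0); case: w' => w' l'; split=> //.
  by split=> //; right.
by rewrite size_cat /= mulSn; apply: leq_add; rewrite // addSn ltnS.
Qed.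

Let d0 : R := set_dist adj0 W0 (f @` W0).
Let d1 : R := set_dist adj1 W1 (g @` W1).

Let lengths (T : Type) (adj : T -> T -> Prop) (A B : set T) : set nat :=
  [set n | exists u u' s, [/\ A u, B u', walk_from_to adj u u' s & size s = n]].

Lemma set_dist_le (T : Type) (adj : T -> T -> Prop) (A B : set T) n :
  lengths adj A B n -> set_dist adj A B <= n%:R :> R.
Proof.
move=> Hn; apply: ge_inf; last by exists n.
by exists 0 => _ [m _ <-].
Qed.

Lemma lengths_project n : lengths adj1 W1 (g @` W1) n ->
  exists2 m, lengths adj0 W0 (f @` W0) m & (m <= n)%N.
Proof.
move=> [a [b [s [Wa [c Wc cb] walk <-]]]]; have [s' walk' sz] := walk_project walk.
exists (size s') => //; exists a.1, b.1, s'; split=> //.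
by exists c.1 => //; rewrite -cb gf.
Qed.

Lemma lengths_lift m : lengths adj0 W0 (f @` W0) m ->
  exists2 n, lengths adj1 W1 (g @` W1) n & (n <= #|U| + m * #|U|.+1)%N.
Proof.
have [p _] : exists p : U, p \in [set: U].
  by have /card_gt0P[p _] := card_gadget_gt0 ok; exists p; rewrite inE.
move=> [u [u' [s [Wu [w Ww wu'] walk <-]]]].
have [s' walk' sz] := walk_lift p (g (w, p)).2 walk.
exists (size s') => //; exists (u, p), (g (w, p)), s'; split; [exact: Wu|by exists (w, p)| |by []].
suff -> : g (w, p) = (u', (g (w, p)).2) by [].
by rewrite [LHS]surjective_pairing gf /= wu'.
Qed.

Hypothesis adj0_connected : graph_connected adj0.
Hypothesis W0_nonempty : W0 !=set0.

Lemma lengths_nonempty : exists m, lengths adj0 W0 (f @` W0) m.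
Proof.
have [w Ww] := W0_nonempty; have [s walk] := adj0_connected w (f w).
by exists (size s), w, (f w), s; split=> //; exists w.
Qed.

Lemma dist_project : d0 <= d1.
Proof.
apply: lb_le_inf.
  have [m /lengths_lift[n Hn _]] := lengths_nonempty.
  by exists n%:R, n.
move=> _ [n /lengths_project[m Hm mn] <-].
by apply: (le_trans (set_dist_le Hm)); rewrite ler_nat.
Qed.

(** A positive distance forces base lengths [m >= 1], so the additive [#|U|] in [#|U| + m * #|U|.+1]
    is absorbed into the factor. *)
Lemma dist_lift : 0 < d0 -> d1 <= (2 * #|U|).+1%:R * d0.
Proof.
move=> d0_gt0; rewrite mulrC -ler_pdivrMr //; apply: lb_le_inf.
  by have [m Hm] := lengths_nonempty; exists m%:R, m.
move=> _ [m Hm <-]; rewrite ler_pdivrMr //.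
have [n Hn nm] := lengths_lift Hm; apply: (le_trans (set_dist_le Hn)).
have m0 : (0 < m)%N by rewrite -(ltr_nat R); exact: lt_le_trans (set_dist_le Hm).
rewrite -natrM ler_nat; clear -nm m0; nia.
Qed.

(** The base vertex of that gadget would lie both in [W0] and in its image, making the distance
    0. *)
Lemma no_within_gadget (t : Trail V1) : 0 < d0 ->
  trails adj1 (incident_edges adj1 W1) (image_edges (incident_edges adj1 W1) g) t ->
  ~ within_gadget t.
Proof.
move=> d0_gt0 Tt Wt; have Wv := within_gadget_first Tt Wt.
case: Tt => _ _ [e [[_ [z [Wz ez]]] eE]].
have [_ /(_ (g z))] := within_gadget_edges Wt; rewrite eE gf => /(_ _) H.
have : lengths adj0 W0 (f @` W0) 0%N.
  exists t.1.1.1, t.1.1.1, [::]; split=> //; exists z.1 => //.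
  by apply: H; exists z.
by move=> /set_dist_le; rewrite leNgt d0_gt0.
Qed.

End Automorphism.

Lemma Zfun_phi_ge : exists2 C : R, 0 < C & forall f g,
  is_aut adj0 f -> is_aut adj1 g -> (forall a, (g a).1 = f a.1) ->
  (Zfun adj0 W0 f h <= C%:E * Zfun adj1 W1 g x)%E.
Proof.
have [N N0 HN] := @esum_cst_le R _ [set: bool] 1 finite_finset ler01.
(* [N] accounts for the two orientations of a trail; adding 1 makes the constant visibly
   positive. *)
exists (#|U|%:R `^ `|0 : R| * (N + 1)).
  by rewrite mulr_gt0 ?powR_gt0 ?ltr0n ?(card_gadget_gt0 ok) // ltr_wpDl.
move=> f g f_aut g_aut gf; rewrite !ZfunE.
apply: (le_trans (esum_midwalks_le adj0_simple _ _ (fun n => h ^+ n / len_weight 0 n))).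
apply: (le_trans (@trails_lift_le R V0 adj0 U eH P port adj0_simple ok lab x h x_gt0 h_ge0 gsum
  _ _ (incident_edges adj1 W1) (image_edges (incident_edges adj1 W1) g) 0
  (@cross_incident _ _ _ _ _ adj0_simple W0) (cross_image adj0_simple f_aut g_aut gf))).
rewrite EFinM -muleA; apply: lee_pmul; [by rewrite lee_fin powR_ge0| |by []|].
  by apply: esum_ge0 => t _; rewrite lee_fin pos.
apply: (le_trans (esum_trails_le adj1_simple _ _ (pos 0))).
rewrite muleC; apply: lee_pmul; [exact: esum_ge0| | |by []].
  by apply: esum_ge0 => t _; rewrite lee_fin pos.
by apply: (le_trans (HN (fun=> 1%E) (fun _ _ => lexx _))); rewrite lee_fin lerDl.
Qed.

(** The positive distance removes the walks confined to one gadget, so that every remaining one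
    contracts. *)
Lemma Zfun_phi_le : exists2 C : R, 0 < C & forall f g,
  is_aut adj0 f -> is_aut adj1 g -> (forall a, (g a).1 = f a.1) ->
  0 < set_dist adj0 W0 (f @` W0) :> R ->
  (Zfun adj1 W1 g x <= C%:E * Zfun adj0 W0 f h)%E.
Proof.
have [N N0 HN] := @esum_cst_le R _ [set: bool] 1 finite_finset ler01.
have [C C0 HC] := @trails_lift_ge R V0 adj0 U eH P port adj0_simple adj0_cubic ok lab
  x h x_gt0 h_ge0 gsum 0.
exists ((C + 1) * (N + 1)); first by rewrite mulr_gt0 // ltr_wpDl.
move=> f g f_aut g_aut gf d_gt0; rewrite !ZfunE.
apply: (le_trans (esum_midwalks_le adj1_simple _ _ (fun n => x ^+ n / len_weight 0 n))).
rewrite -[X in esum X](_ : trails adj1 (incident_edges adj1 W1)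
   (image_edges (incident_edges adj1 W1) g) `&` ~` @within_gadget V0 U = _); last first.
  apply/setIidl => t Tt; exact: (no_within_gadget gf d_gt0 Tt).
apply: (le_trans (HC (incident_edges adj0 W0) (image_edges (incident_edges adj0 W0) f) _ _ _ _)).
- by move=> c d w; exact: base_incident.
- by move=> c d w; exact: base_image.
rewrite EFinM -muleA; apply: lee_pmul; [by rewrite lee_fin| |by rewrite lee_fin lerDl|].
  by apply: esum_ge0 => t _; rewrite lee_fin pos_h.
apply: (le_trans (esum_trails_le adj0_simple _ _ (pos_h 0))).
rewrite muleC; apply: lee_pmul; [exact: esum_ge0| | |by []].
  by apply: esum_ge0 => t _; rewrite lee_fin pos_h.
by apply: (le_trans (HN (fun=> 1%E) (fun _ _ => lexx _))); rewrite lee_fin lerDl.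
Qed.

End Transfer.

(** * Transfer of the two exponents *)

Theorem theorem3p4 (R : realType) (V0 : Type) (adj0 : V0 -> V0 -> Prop)
    (U : finType) (eH : rel U) (P : {set U}) (port : V0 -> V0 -> U)
    (W0 : set V0) :
  simple_graph adj0 -> infinite_graph V0 -> graph_connected adj0 ->
  quasi_transitive adj0 -> cubic adj0 ->
  gadget_ok eH P -> port_labelling adj0 P port ->
  (* automorphisms of G0 induce automorphisms of G1 = phi(G0) *)
  (forall f, is_aut adj0 f ->
     exists g, is_aut (phi_adj adj0 eH port) g /\ forall a, (g a).1 = f a.1) ->
  graph_connected (phi_adj adj0 eH port) ->
  minimal_fundamental_domain adj0 W0 ->
  forall g0 : R, gamma_is adj0 W0 g0%:E ->
    gamma_is (phi_adj adj0 eH port) (@gadget_domain V0 U W0) g0%:E /\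
    (forall e : \bar R,
       eta_is (phi_adj adj0 eH port) (@gadget_domain V0 U W0) e ->
       eta_is adj0 W0 e).
Proof.
move=> simple0 infinite0 conn0 _ cubic0 ok lab induced conn1 [dom0 _] g0 gam0.
set adj1 := phi_adj adj0 eH port; set W1 := gadget_domain W0.
have [D0 deg0] := @base_degree_le R V0 adj0 U P port lab.
have [D1 deg1] := @phi_degree_le R V0 adj0 U eH P port simple0 lab.
have dom1 := phi_fundamental_domain induced dom0.
have simple1 : simple_graph adj1 := phi_adj_simple port simple0 ok.
have [finW0 dom0'] := dom0.
have [p [q [pP qP pq]]] : exists p q, [/\ p \in P, q \in P & p != q].
  by apply/card_gt1P; case: ok => _ _ _ ->.
have key v0 : exists x : R, [/\ 0 < x,
    forall i j, i \in P -> j \in P -> i != j ->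
      gpath_sum eH x i j = ((conn_const adj0 v0)^-1)%:E &
    forall v1, conn_const adj1 v1 = x^-1].
  have c_gt0 := gamma_conn_const_gt0 v0 simple0 deg0 dom0 gam0.
  have h_gt0 : 0 < (conn_const adj0 v0 : R)^-1 by rewrite invr_gt0.
  have [x x_gt0 xE] := gpath_sum_onto ok p q h_gt0.
  have gsum i j : i \in P -> j \in P -> i != j ->
      gpath_sum eH x i j = ((conn_const adj0 v0)^-1)%:E.
    by move=> iP jP ij; rewrite -xE; apply: (gpath_sum_port ok) => //; exact: ltW.
  exists x; split=> //.
  (* A finite [g0] provides exponents on both sides: divergence at [g0 - 1] and convergence at
     [g0 + 1], both carried over to the transformed graph. *)
  apply: (conn_const_radius (y1 := g0 - 1) (y2 := g0 + 1) simple1 deg1 conn1 dom1 x_gt0).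
    apply: (Yfun_phi_infty simple0 ok lab x_gt0 (ltW h_gt0) gsum).
    by have [H _] := gam0 v0 (g0 - 1); apply: H; rewrite lte_fin; lra.
  apply: (Yfun_phi_lty simple0 cubic0 ok lab finW0 x_gt0 (ltW h_gt0) gsum).
  by have [_ H] := gam0 v0 (g0 + 1); apply: H; rewrite lte_fin; lra.
split.
  (* The base constant is read at [v.1], while [cE] gives the constant of the transformed graph at
     every vertex, in particular at [v]. *)
  move=> v y; have [x [x_gt0 gsum cE]] := key v.1.
  have h_ge0 : 0 <= (conn_const adj0 v.1 : R)^-1 by rewrite invr_ge0 conn_const_ge0.
  have [H1 H2] := gam0 v.1 y; rewrite cE invrK; split=> yg.
    exact: (Yfun_phi_infty simple0 ok lab x_gt0 h_ge0 gsum (H1 yg)).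
  exact: (Yfun_phi_lty simple0 cubic0 ok lab finW0 x_gt0 h_ge0 gsum (H2 yg)).
move=> e eta1 v alpha alpha_aut dist_oo w.
have [x [x_gt0 gsum cE]] := key v.
have h_ge0 : 0 <= (conn_const adj0 v : R)^-1 by rewrite invr_ge0 conn_const_ge0.
have /choice[g Hg] k := induced (alpha k) (alpha_aut k).
have W0n : W0 !=set0 by have [f [_ ?]] := dom0' v; exists (f v).
have dist_le k : set_dist adj0 W0 (alpha k @` W0) <= set_dist adj1 W1 (g k @` W1) :> R.
  by have [g_aut gf] := Hg k; exact: (dist_project port ok gf conn0 W0n).
have dist_ge k : 0 < set_dist adj0 W0 (alpha k @` W0) :> R ->
    set_dist adj1 W1 (g k @` W1) <= (2 * #|U|).+1%:R * set_dist adj0 W0 (alpha k @` W0) :> R.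
  by have [g_aut gf] := Hg k; exact: (dist_lift port ok gf conn0 W0n).
have dist1_oo : (fun k => set_dist adj1 W1 (g k @` W1)) @ \oo --> (+oo : set_system R).
  by apply: ger_cvgy dist_oo; apply: nearW.
have := eta1 (v, p) g (fun k => proj1 (Hg k)) dist1_oo w.
rewrite cE invrK; set h := (conn_const adj0 v)^-1 in gsum h_ge0 *.
have [C1 C1_gt0 HC1] := Zfun_phi_ge W0 simple0 ok lab x_gt0 h_ge0 gsum.
have [C2 C2_gt0 HC2] := Zfun_phi_le W0 simple0 cubic0 ok lab x_gt0 h_ge0 gsum.
pose K : R := (2 * #|U|).+1%:R.
have K_ge1 : 1 <= K by rewrite ler1n.
have K_gt0 : 0 < K by apply: lt_le_trans K_ge1.
have KK_gt0 : 0 < K `^ `|w| by rewrite powR_gt0.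
set a := fun k => (Zfun adj0 _ _ _ * _)%E; set b := fun k => (Zfun adj1 _ _ _ * _)%E.
(* Positive distances are needed twice: to compare their powers, and to discard the walks inside one
   gadget. *)
have near_pos : \forall k \near \oo, 0 < set_dist adj0 W0 (alpha k @` W0) :> R.
  by move/cvgryPgt: dist_oo => /(_ 0).
have Z_ge0 (T : Type) (adj : T -> T -> Prop) W f (z : R) : 0 <= z -> (0 <= Zfun adj W f z)%E.
  by move=> z0; apply: esum_ge0 => ? _; rewrite lee_fin exprn_ge0.
have ab : \forall k \near \oo, (0 <= a k <= (C1 * K `^ `|w|)%:E * b k)%E.
  apply: filterS near_pos => k d_gt0.
  have d1_gt0 := lt_le_trans d_gt0 (dist_le k).
  have [g_aut gf] := Hg k.
  rewrite /a /b mule_ge0 ?Z_ge0 ?lee_fin ?powR_ge0 //= EFinM muleACA.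
  apply: lee_pmul; rewrite ?Z_ge0 ?lee_fin ?powR_ge0 //; first exact: HC1.
  apply: powR_comparable => //; last exact: dist_ge.
  by apply: (le_trans (dist_le k)); rewrite ler_peMl // ltW.
have ba : \forall k \near \oo, (b k <= (C2 * K `^ `|w|)%:E * a k)%E.
  apply: filterS near_pos => k d_gt0.
  have d1_gt0 := lt_le_trans d_gt0 (dist_le k).
  have [g_aut gf] := Hg k.
  rewrite /a /b EFinM muleACA.
  apply: lee_pmul; rewrite ?Z_ge0 ?lee_fin ?powR_ge0 ?(ltW x_gt0) //; first exact: HC2.
  apply: powR_comparable => //; first exact: dist_ge.
  by apply: (le_trans (dist_le k)); rewrite ler_peMl // ltW.
move=> [Hlow Hhigh]; split=> we.
  apply: (squeeze_cvge ab); first exact: cvg_cst.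
  by rewrite -(mule0 (C1 * K `^ `|w|)%:E); apply: cvgeZl => //; exact: Hlow.
have CK_gt0 : 0 < C2 * K `^ `|w| by rewrite mulr_gt0.
apply/cvgeyPge => A; have /cvgeyPge := Hhigh we.
move=> /(_ (C2 * K `^ `|w| * A)) bA; near=> k.
have H1 : ((C2 * K `^ `|w| * A)%:E <= b k)%E by near: k.
have H2 : (b k <= (C2 * K `^ `|w|)%:E * a k)%E by near: k.
by have := le_trans H1 H2; rewrite EFinM lee_pmul2l // lte_fin.
Unshelve. all: by end_near.
Qed.
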